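(* Consider the manifold $\mathcal{Q}_\rho$ with the tautological bundle $\mathcal{E}$ and the coefficient bundle $\mathcal{C}$. Then: 1. There exist $\mathcal{U}(\theta)$-invariant connections in $\mathcal{E}$ and in $\mathcal{C}$, namely $D_X\sigma=q(X\bullet\sigma)$ in $\mathcal{E}$ and the connection in $\mathcal{C}$ linked to it by Leibniz' rule $(D_X\varphi)\sigma=D_X(\varphi\sigma)-\varphi(D_X\sigma)$, for sections $\sigma$ of $\mathcal{E}$ and $\varphi$ of $\mathcal{C}$. 2. There exists a Hilbertian product in $T\mathcal{Q}_\rho$ with values in $\mathcal{C}$, namely $\langle X,Y\rangle_q=[(\mathbf{x},-\theta(X\mathbf{x},Y\mathbf{x}))]$ ($p_{\mathbf{x}}=q$). This product is compatible with the right $\mathcal{C}$-module structure of $T\mathcal{Q}_\rho$: $\langle X,Y\cdot\varphi\rangle_q=\langle X,Y\rangle_q\,\varphi$ for $X,Y\in(T\mathcal{Q}_\rho)_q$, $\varphi\in\mathcal{C}_q$. 3. The imaginary part $\omega$ of the Hilbertian product in $T\mathcal{Q}_\rho$ is, up to the constant $\frac i2$, the curvature $R$ of the connection $D$ of $\mathcal{E}$: $\omega(X,Y)_q=\frac i2R(X,Y)_q$. (In this sense, the symplectic form $\omega$ is exact.) 4. For every $\tilde a\in\mathfrak{U}(\theta)$ the map $f_{\tilde a}$ is a moment map: the field $X_{\tilde a}(q)=[\tilde a,q]$ is the symplectic gradient of the section $f_{\tilde a}$ of $\mathcal{C}$, i.e. $D_Yf_{\tilde a}=\omega(X_{\tilde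 a},Y)$ for every tangent vector $Y$ of $\mathcal{Q}_\rho$, where $D$ is the covariant derivative of $\mathcal{C}$.
   Context: $\mathcal{A}$ is a unital C$^*$-algebra with unitary group $\mathcal{U}_{\mathcal{A}}$; $M_2(\mathcal{A})$ acts on the right $\mathcal{A}$-module $\mathcal{A}^2$ of column vectors $\mathbf{x}=(x_1,x_2)^t$, and $\mathbf{x}^*=(x_1^*,x_2^* )$. Let $\rho=\begin{pmatrix}1&0\\0&-1\end{pmatrix}$ and $\theta(\mathbf{x},\mathbf{y})=\mathbf{x}^*\rho\mathbf{y}=x_1^*y_1-x_2^*y_2$. For $\tilde a\in M_2(\mathcal{A})$ put $\tilde a^\sharp=\rho\tilde a^*\rho$. $\mathcal{U}(\theta)=\{\tilde a\in Gl_2(\mathcal{A}):\tilde a^\sharp=\tilde a^{-1}\}$, a Banach-Lie group with Lie algebra $\mathfrak{U}(\theta)=\{\tilde a\in M_2(\mathcal{A}):\tilde a^\sharp=-\tilde a\}$. $\mathcal{Q}_\rho$ is the set of idempotents $q\in M_2(\mathcal{A})$ with $q^\sharp=q$ such that $\theta(\mathbf{x},\mathbf{x})\ge0$ on the range $R(q)$ and $\theta(\mathbf{x},\mathbf{x})\le 0$ on the nullspace $N(q)$. It is a complemented $C^\infty$ submanifold of $M_2(\mathcal{A})$ with $(T\mathcal{Q}_\rho)_q=\{X\in M_2(\mathcal{A}):\rho X^*\rho=X,\ Xq+qX=X\}$. $\mathcal{U}(\theta)$ acts on $\mathcal{Q}_\rho$ by $q\mapsto\tilde mq\tilde m^{-1}$.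 Let $\mathcal{K}=\{\mathbf{x}\in\mathcal{A}^2:\theta(\mathbf{x},\mathbf{x})=1,\ x_1\text{ invertible}\}$ and, for $\mathbf{x}\in\mathcal{K}$, $p_{\mathbf{x}}=\mathbf{x}\mathbf{x}^*\rho\in\mathcal{Q}_\rho$; every $q\in\mathcal{Q}_\rho$ is $p_{\mathbf{x}}$ for some $\mathbf{x}\in\mathcal{K}$, unique up to $\mathbf{x}\mapsto\mathbf{x}u$, $u\in\mathcal{U}_{\mathcal{A}}$, and $\{\mathbf{x}\}$ is a basis of the right $\mathcal{A}$-module $R(q)$. Tautological bundle: $\mathcal{E}=\{(q,\mathbf{x}):q\in\mathcal{Q}_\rho,\ \mathbf{x}\in R(q)\}\to\mathcal{Q}_\rho$, with $\mathcal{U}(\theta)$ acting by $\tilde m\cdot(q,\mathbf{x})=(\tilde mq\tilde m^{-1},\tilde m\mathbf{x})$. $X\bullet\sigma$ is the directional derivative of a section $\sigma$ regarded as an $\mathcal{A}^2$-valued function. The curvature of $D$ is $R(X,Y)\sigma=D_XD_Y\sigma-D_YD_X\sigma-D_{[X,Y]}\sigma$. Coefficient bundle $\mathcal{C}$: its fiber over $q$ is the space $\mathcal{C}_q=\mathcal{L}_{\mathcal{A}}(R(q))$ of right $\mathcal{A}$-module endomorphisms of $R(q)$, with $\mathcal{U}(\theta)$ acting by $\tilde m\cdot(q,\varphi)=(\tilde mq\tilde m^{-1},\tilde m\varphi\tilde m^{-1})$. For $\mathbf{x}\in\mathcal{K}$ with $p_{\mathbf{x}}=q$ and $a\in\mathcal{A}$,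 $[(\mathbf{x},a)]\in\mathcal{C}_q$ is the endomorphism $\mathbf{x}b\mapsto\mathbf{x}ab$; so $[(\mathbf{x},a)]=[(\mathbf{x}u,u^*au)]$ for $u\in\mathcal{U}_{\mathcal{A}}$. The map $a\mapsto[(\mathbf{x},a)]$ makes $\mathcal{C}_q$ a C$^*$-algebra isomorphic to $\mathcal{A}$, independently of $\mathbf{x}$. $\operatorname{Im}c=\frac1{2i}(c-c^* )$. Module structure: for $X\in(T\mathcal{Q}_\rho)_q$ and $\varphi=[(\mathbf{x},a)]\in\mathcal{C}_q$, $X\cdot\varphi$ is the unique $Z\in(T\mathcal{Q}_\rho)_q$ with $Z\mathbf{x}=X\mathbf{x}a$ (it does not depend on $\mathbf{x}$). A Hilbertian product with values in $\mathcal{C}$ is a family of $\mathcal{C}_q$-valued maps $\langle\cdot,\cdot\rangle_q$ on $(T\mathcal{Q}_\rho)_q$ that are additive in each variable, with $\langle Y,X\rangle_q=\langle X,Y\rangle_q^*$, $\langle X,X\rangle_q\ge0$, and linear in the second variable for the complex structure of $(T\mathcal{Q}_\rho)_q$ given by $\mathcal{I}_qX=iX(2q-1)$. Symplectic form: $\omega(X,Y)_q=\operatorname{Im}\langle X,Y\rangle_q$. Moment map: for $\tilde a\in\mathfrak{U}(\theta)$ and $q=p_{\mathbf{x}}\in\mathcal{Q}_\rho$, $f_{\tilde a}(q)=\frac1{2i}[(\mathbf{x},\theta(\mathbf{x},\tilde a\mathbf{x}))]\in\mathcal{C}_q$ (independent of $\mathbf{x}$). *)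

(* Defs.v *)
From HB Require Import structures.
From mathcomp Require Import all_boot all_order all_algebra complex.
From mathcomp Require Import all_classical all_reals all_analysis.

Set Implicit Arguments.
Unset Strict Implicit.
Unset Printing Implicit Defensive.

Import Order.TTheory GRing.Theory Num.Theory numFieldNormedType.Exports.

Local Open Scope classical_set_scope.
Local Open Scope complex_scope.
Local Open Scope ring_scope.

(* Unital complex C*-algebras (nonzero, since an [algType] satisfies 1 != 0).
   The norm is a separate operation with values in [R], because a type carrying
   both a ring and a normed Z-module structure has to be a [numDomainType]. *)
HB.mixin Record isCStarAlgebra (R : realType) A of GRing.Algebra R[i] A := {
  cstar : A -> A;
  cnorm : A -> R;
  cstarK : involutive cstar;
  cstarD : {morph cstar : a b / a + b};
  cstarZ : forall (z : R[i]) (a : A), cstar (z *: a) = conjc z *: cstar a;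
  cstarM : forall a b : A, cstar (a * b) = cstar b * cstar a;
  cnormD : forall a b : A, cnorm (a + b) <= cnorm a + cnorm b;
  cnormZ : forall (z : R[i]) (a : A), (cnorm (z *: a))%:C = `|z| * (cnorm a)%:C;
  cnorm0_eq0 : forall a : A, cnorm a = 0 -> a = 0;
  cnormM : forall a b : A, cnorm (a * b) <= cnorm a * cnorm b;
  cnorm_cstarM : forall a : A, cnorm (cstar a * a) = cnorm a ^+ 2;
  cnorm_complete : forall u : nat -> A,
    (forall e, 0 < e -> exists N, forall m n, (N <= m)%N -> (N <= n)%N ->
       cnorm (u m - u n) < e) ->
    exists l, cnorm (u n - l) @[n --> \oo] --> (0 : R)
}.

#[short(type="cstarAlgType")]
HB.structure Definition CStarAlgebra (R : realType) :=
  {A of isCStarAlgebra R A & GRing.Algebra R[i] A}.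

(* Matrices over [A] as a real normed space: differentiation is over the real
   scalars, although [A] is complex ([Q_rho] is only a real manifold).  The norm
   is equivalent to the C*-norm of M_2(A), resp. to the usual norms of A^2. *)
Definition rmatrix (R : realType) (A : cstarAlgType R) (m n : nat) : Type :=
  'M[A]_(m, n).

Section RealMatrixSpace.
Context (R : realType) (A : cstarAlgType R) (m n : nat).

HB.instance Definition _ := GRing.Zmodule.on (rmatrix A m n).

Definition realscale (r : R) (M : rmatrix A m n) : rmatrix A m n :=
  (r%:C)%:A *: (M : 'M[A]_(m, n)).

Let realscaleA r s M : realscale r (realscale s M) = realscale (r * s) M.
Proof.
rewrite /realscale scalerA rmorphM -scalerAl mul1r; congr (_ *: _).
by rewrite scalerA.
Qed.

Let realscale1 : left_id 1 realscale.
Proof. by move=> M; rewrite /realscale rmorph1 !scale1r. Qed.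

Let realscaleDr : right_distributive realscale +%R.
Proof. by move=> r M N; rewrite /realscale scalerDr. Qed.

Let realscaleDl M : {morph realscale^~ M : r s / r + s}.
Proof. by move=> r s; rewrite /realscale rmorphD !scalerDl. Qed.

HB.instance Definition _ := GRing.Zmodule_isLmodule.Build R (rmatrix A m n)
  realscaleA realscale1 realscaleDr realscaleDl.

Definition realnorm (M : rmatrix A m n) : R :=
  \sum_(i < m) \sum_(j < n) cnorm ((M : 'M[A]_(m, n)) i j).

Let cnormZr (r : R) (a : A) : cnorm (r%:C *: a) = `|r| * cnorm a.
Proof.
have := cnormZ r%:C a; rewrite normc_def /= expr0n addr0 sqrtr_sqr.
by rewrite -rmorphM => /complexI.
Qed.

Let cnorm_ge0 (a : A) : 0 <= cnorm a.
Proof.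
have c0 : cnorm (0 : A) = 0.
  by have := cnormZr 0 0; rewrite scaler0 normr0 mul0r.
have := cnormD a (- a); rewrite subrr c0.
have -> : cnorm (- a) = cnorm a.
  by have := cnormZr (- 1) a; rewrite rmorphN rmorph1 scaleN1r normrN1 mul1r.
by rewrite -mulr2n pmulrn_lge0.
Qed.

Let realnormD M N : realnorm (M + N) <= realnorm M + realnorm N.
Proof.
rewrite /realnorm -big_split; apply: ler_sum => i _.
rewrite -big_split; apply: ler_sum => j _.
by rewrite mxE; exact: cnormD.
Qed.

Let realnormZ (r : R) M : realnorm (r *: M) = `|r| * realnorm M.
Proof.
rewrite /realnorm mulr_sumr; apply: eq_bigr => i _.
rewrite mulr_sumr; apply: eq_bigr => j _.
by rewrite mxE -scalerAl mul1r; exact: cnormZr.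
Qed.

Let realnorm0_eq0 M : realnorm M = 0 -> M = 0.
Proof.
move=> M0; apply/matrixP => i j; rewrite mxE; apply: cnorm0_eq0.
have M_ge0 k : true -> 0 <= \sum_(l < n) cnorm ((M : 'M[A]_(m, n)) k l).
  by move=> _; exact: sumr_ge0.
have /eqP := M0; rewrite /realnorm psumr_eq0 // => /allP /(_ i).
rewrite mem_index_enum => /(_ isT) /=; rewrite psumr_eq0 // => /allP /(_ j).
by rewrite mem_index_enum => /(_ isT) /eqP.
Qed.

HB.instance Definition _ := Lmodule_isNormed.Build R (rmatrix A m n)
  realnormD realnormZ realnorm0_eq0.

End RealMatrixSpace.

(* [f] is of class C^n on the open set [U]; the differential of [f] is viewed
   as the function (x, v) |-> 'd f x v on U x E, so that n = oo below is
   C^oo in the usual Frechet sense. *)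
Fixpoint class_C (R : realType) (n : nat) (E F : normedModType R)
    (U : set E) (f : E -> F) : Prop :=
  match n with
  | 0 => forall x, U x -> {for x, continuous f}
  | k.+1 => (forall x, U x -> differentiable f x) /\
            class_C k (U `*` [set: E]) (fun p : E * E => 'd f (p.1) (p.2))
  end.

Section Qrho.
Context (R : realType) (A : cstarAlgType R).
Implicit Types (x y v w : 'cV[A]_2) (q X Y Z a m : 'M[A]_2).

Definition starmx (k l : nat) (M : 'M[A]_(k, l)) : 'M[A]_(l, k) :=
  \matrix_(i, j) cstar (M j i).

Definition rho : 'M[A]_2 := \matrix_(i, j) ((-1) ^+ i *+ (i == j)).

Definition theta x y : A := (starmx x *m rho *m y) 0 0.

Definition sharp a : 'M[A]_2 := rho *m starmx a *m rho.

(* [m] is invertible with inverse [sharp m]; below, the inverse of such an [m]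
   is written [sharp m]. *)
Definition unitary_theta m : Prop :=
  m *m sharp m = 1%:M /\ sharp m *m m = 1%:M.

Definition lie_theta a : Prop := sharp a = - a.

Definition cpositive (b : A) : Prop := exists c : A, b = cstar c * c.

Definition range_of q : set 'cV[A]_2 := [set v | exists w, v = q *m w].

Definition null_of q : set 'cV[A]_2 := [set v | q *m v = 0].

Definition Qrho : set 'M[A]_2 := [set q |
  [/\ q *m q = q, sharp q = q,
      forall v, range_of q v -> cpositive (theta v v) &
      forall v, null_of q v -> cpositive (- theta v v)]].

Definition tangent q : set 'M[A]_2 :=
  [set X | rho *m starmx X *m rho = X /\ X *m q + q *m X = X].

Definition Kset : set 'cV[A]_2 := [set x |
  theta x x = 1 /\ exists b, x 0 0 * b = 1 /\ b * x 0 0 = 1].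

Definition proj_of x : 'M[A]_2 := x *m starmx x *m rho.

(* The right module structure of A^2; 1 x 1 matrices are scalars. *)
Definition rmul v (b : A) : 'cV[A]_2 := v *m b%:M.

(* Multiplication by a complex number, in any left [A]-module: [z%:A] is a
   central element of [A]. *)
Definition complex_scale (V : lmodType A) (z : R[i]) (v : V) : V := (z%:A : A) *: v.

Definition smooth (E F : normedModType R) (U : set E) (f : E -> F) : Prop :=
  forall n, class_C n U f.

(* Smooth maps on the submanifold [Q_rho] are those which extend locally to
   smooth maps on open sets of M_2(A); values outside [Q_rho] are irrelevant. *)
Definition smoothQ (F : normedModType R) (f : 'M[A]_2 -> F) : Prop :=
  forall q, Qrho q -> exists (U : set (rmatrix A 2 2)) (g : rmatrix A 2 2 -> F),
    [/\ open U, U q, smooth U g & forall p, U p -> Qrho p -> f p = g p].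

(* Derivative of [f] at [q] in the direction of the tangent vector [X], by means
   of the curves of [Q_rho] through [q] with velocity [X]. *)
Definition dirder (F : normedModType R) (f : 'M[A]_2 -> F) q X : F :=
  xget 0 [set d : F | forall g : R -> 'M[A]_2,
    (\forall t \near (0 : R), Qrho (g t)) -> g 0 = q ->
    is_derive (0 : R^o) (1 : R^o) (g : R^o -> rmatrix A 2 2) X ->
    is_derive (0 : R^o) (1 : R^o) (f \o g : R^o -> F) d].

Definition vector_field (X : 'M[A]_2 -> 'M[A]_2) : Prop :=
  (forall q, Qrho q -> tangent q (X q)) /\ @smoothQ (rmatrix A 2 2) X.

Definition lie_bracket (X Y : 'M[A]_2 -> 'M[A]_2) q : 'M[A]_2 :=
  @dirder (rmatrix A 2 2) Y q (X q) - @dirder (rmatrix A 2 2) X q (Y q).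

(* A vector bundle over [Q_rho] with an action of [U(theta)].  [fiber_eq q] is
   the equality of the fiber over [q]: elements of a fiber may have several
   representatives in [btype].  [bsmooth] says when a section is smooth. *)
Record bundle := Bundle {
  btype :> lmodType A;
  fiber : 'M[A]_2 -> set btype;
  fiber_eq : 'M[A]_2 -> btype -> btype -> Prop;
  bact : 'M[A]_2 -> btype -> btype;
  bsmooth : ('M[A]_2 -> btype) -> Prop }.

Definition bsection (B : bundle) (s : 'M[A]_2 -> B) : Prop :=
  (forall q, Qrho q -> fiber q (s q)) /\ bsmooth s.

Definition tautological : bundle := @Bundle 'cV[A]_2
  range_of (fun _ v w => v = w) (fun m v => m *m v)
  (fun s => @smoothQ (rmatrix A 2 1) s).

(* Right [A]-module endomorphisms of [R(q)] are represented by functions on A^2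
   whose values outside [R(q)] are irrelevant. *)
Definition endo q (phi : 'cV[A]_2 -> 'cV[A]_2) : Prop :=
  [/\ forall v, range_of q v -> range_of q (phi v),
      forall v w, range_of q v -> range_of q w -> phi (v + w) = phi v + phi w &
      forall v b, range_of q v -> phi (rmul v b) = rmul (phi v) b].

Definition endo_eq q (phi psi : 'cV[A]_2 -> 'cV[A]_2) : Prop :=
  forall v, range_of q v -> phi v = psi v.

(* A section of the bundle of endomorphisms of a bundle is smooth when it maps
   smooth sections to smooth sections. *)
Definition coefficient : bundle := @Bundle ('cV[A]_2 -> 'cV[A]_2)
  endo endo_eq (fun m phi v => m *m phi (sharp m *m v))
  (fun phi => forall s, bsection (s : 'M[A]_2 -> tautological) ->
     @smoothQ (rmatrix A 2 1) (fun q => phi q (s q))).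

(* [D q X s] is the derivative at [q] of the section [s] in the direction of
   the tangent vector [X].  Locality is required explicitly because Banach
   manifolds need not have smooth cutoff functions. *)
Record connection (B : bundle)
    (D : 'M[A]_2 -> 'M[A]_2 -> ('M[A]_2 -> B) -> B) : Prop := {
  connection_fiber : forall q X s, Qrho q -> tangent q X -> bsection s ->
    fiber q (D q X s);
  connection_smooth : forall (X : 'M[A]_2 -> 'M[A]_2) s,
    vector_field X -> bsection s -> bsection (fun q => D q (X q) s);
  connection_local : forall q X s t (U : set (rmatrix A 2 2)),
    Qrho q -> tangent q X -> bsection s -> bsection t -> open U -> U q ->
    (forall p, U p -> Qrho p -> fiber_eq p (s p) (t p)) ->
    fiber_eq q (D q X s) (D q X t);
  connection_linearl : forall q X Y s (r : R),
    Qrho q -> tangent q X -> tangent q Y -> bsection s ->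
    fiber_eq q (D q (complex_scale r%:C X + Y) s) (complex_scale r%:C (D q X s) + D q Y s);
  connection_linearr : forall q X s t (z : R[i]),
    Qrho q -> tangent q X -> bsection s -> bsection t ->
    fiber_eq q (D q X (fun p => complex_scale z (s p) + t p))
               (complex_scale z (D q X s) + D q X t);
  connection_leibniz : forall q X s (f : 'M[A]_2 -> R^o),
    Qrho q -> tangent q X -> bsection s -> smoothQ f ->
    fiber_eq q (D q X (fun p => complex_scale (f p)%:C (s p)))
               (complex_scale (dirder f q X)%:C (s q) + complex_scale (f q)%:C (D q X s)) }.

Definition invariant_connection (B : bundle)
    (D : 'M[A]_2 -> 'M[A]_2 -> ('M[A]_2 -> B) -> B) : Prop :=
  forall m q X s, unitary_theta m -> Qrho q -> tangent q X -> bsection s ->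
    fiber_eq (m *m q *m sharp m)
      (D (m *m q *m sharp m) (m *m X *m sharp m)
         (fun p => bact m (s (sharp m *m p *m m))))
      (bact m (D q X s)).

Definition curvature (B : bundle)
    (D : 'M[A]_2 -> 'M[A]_2 -> ('M[A]_2 -> B) -> B)
    (X Y : 'M[A]_2 -> 'M[A]_2) (s : 'M[A]_2 -> B) q : B :=
  D q (X q) (fun p => D p (Y p) s) - D q (Y q) (fun p => D p (X p) s)
  - D q (lie_bracket X Y q) s.

Definition conn_taut q X (s : 'M[A]_2 -> tautological) : tautological :=
  q *m (@dirder (rmatrix A 2 1) s q X : 'cV[A]_2).

Definition linked_connection
    (D : 'M[A]_2 -> 'M[A]_2 -> ('M[A]_2 -> coefficient) -> coefficient) : Prop :=
  forall q X (phi : 'M[A]_2 -> coefficient) (s : 'M[A]_2 -> tautological),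
    Qrho q -> tangent q X -> bsection phi -> bsection s ->
    D q X phi (s q) =
      conn_taut q X (fun p => phi p (s p)) - phi q (conn_taut q X s).

(* phi = [(x, b)] *)
Definition is_class x (b : A) (phi : 'cV[A]_2 -> 'cV[A]_2) : Prop :=
  forall c : A, phi (rmul x c) = rmul x (b * c).

(* The C*-algebra structure of [C_q] is transported from [A] by the maps
   b |-> [(x, b)], where [x] is any element of [K] with [proj_of x = q]; every
   [q] in [Q_rho] is of this form and the result does not depend on [x]. *)
Definition is_adjoint q (phi psi : 'cV[A]_2 -> 'cV[A]_2) : Prop :=
  forall x b, Kset x -> proj_of x = q -> is_class x b phi ->
    is_class x (cstar b) psi.

Definition endo_positive q (phi : 'cV[A]_2 -> 'cV[A]_2) : Prop :=
  forall x b, Kset x -> proj_of x = q -> is_class x b phi -> cpositive b.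

Definition is_imaginary_part q (phi psi : 'cV[A]_2 -> 'cV[A]_2) : Prop :=
  forall x b, Kset x -> proj_of x = q -> is_class x b phi ->
    is_class x ((2%:R * 'i%C)^-1 *: (b - cstar b)) psi.

(* Z = X . phi *)
Definition is_module_action q X (phi : 'cV[A]_2 -> 'cV[A]_2) Z : Prop :=
  tangent q Z /\ exists x b, [/\ Kset x, proj_of x = q, is_class x b phi &
    Z *m x = rmul (X *m x) b].

Definition complex_structure q X : 'M[A]_2 :=
  complex_scale 'i%C (X *m (q *+ 2 - 1%:M)).

Record hilbertian_product
    (h : 'M[A]_2 -> 'M[A]_2 -> 'M[A]_2 -> 'cV[A]_2 -> 'cV[A]_2) : Prop := {
  hilbertian_fiber : forall q X Y, Qrho q -> tangent q X -> tangent q Y ->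
    endo q (h q X Y);
  hilbertian_addl : forall q X Y Z,
    Qrho q -> tangent q X -> tangent q Y -> tangent q Z ->
    endo_eq q (h q (X + Y) Z) (h q X Z \+ h q Y Z);
  hilbertian_addr : forall q X Y Z,
    Qrho q -> tangent q X -> tangent q Y -> tangent q Z ->
    endo_eq q (h q X (Y + Z)) (h q X Y \+ h q X Z);
  hilbertian_sym : forall q X Y, Qrho q -> tangent q X -> tangent q Y ->
    is_adjoint q (h q X Y) (h q Y X);
  hilbertian_pos : forall q X, Qrho q -> tangent q X ->
    endo_positive q (h q X X);
  hilbertian_linear : forall q X Y (r s : R),
    Qrho q -> tangent q X -> tangent q Y ->
    endo_eq q
      (h q X (complex_scale r%:C Y + complex_scale s%:C (complex_structure q Y)))
      (fun v => complex_scale (r +i* s) (h q X Y v)) }.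

End Qrho.

(* Main.v *)
From HB Require Import structures.
Require Import Defs.
From mathcomp Require Import all_boot all_order all_algebra complex.
From mathcomp Require Import all_classical all_reals all_analysis.
From mathcomp Require Import ring lra.

Set Implicit Arguments.
Unset Strict Implicit.
Unset Printing Implicit Defensive.

Import Order.TTheory GRing.Theory Num.Theory numFieldNormedType.Exports.

Local Open Scope classical_set_scope.
Local Open Scope complex_scope.
Local Open Scope ring_scope.

(** On [R(q)] everything is a compression by [q].  For [x] in [Kset] and
    [q = proj_of x], the endomorphism [v |-> q *m M *m v] sends [x c] to
    [x theta(x, M x) c], so it is [[(x, theta(x, M x))]] for every admissible
    [x] at once ([compression_class]).  This removes the choice of [x] from all
    the objects of the theorem:
    - the Hilbertian product is [- q X Y], since [theta(x, X Y x) =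
      theta(X x, Y x)] for tangent [X];
    - its imaginary part is [(2i)^-1 q (Y X - X Y)];
    - the moment map of [a] is [(2i)^-1 q a].
    Positivity of the product is the condition on [N(q)] in the definition of
    [Qrho], because [X x] lies in [N(q)] ([tangent_null]).

    Differentiating [s = q s] along [X] gives [X . s = q (X . s) + X s].  Hence
    in [D_X D_Y s - D_Y D_X s - D_[X,Y] s] the second derivatives of [s] and the
    first derivatives of the fields cancel against [D_[X,Y] s], and what
    is left is [q (X Y - Y X) s] ([conn_taut_curvature]); as [1/(2i) = -i/2],
    this is the imaginary part up to [i/2].

    A section [phi] of the coefficient bundle is replaced by the matrix
    [coefmx phi p] with columns [phi_p (p e_j)], which satisfies
    [phi_p (p w) = coefmx phi p *m w].  The linked connection then is
    [q (X . coefmx phi)], an expression in which the section [s] of Leibniz' rule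
    only enters through its value, so that the connection is well defined; its
    invariance and its smoothness are those of directional derivatives of matrix
    functions.

    The analysis behind these computations has three parts.  Directional
    derivatives are defined by means of curves, so each tangent vector must be
    the velocity of a curve in [Qrho]: with [W = [X, q] / 2], the Cayley transforms
    [(1 - tW)^-1 (1 + tW)] are unitary and move [q] along such a curve
    ([curve_exists]); the inverse is a Neumann series.  Then a directional
    derivative is the differential of any local extension ([dirder_ext]).  The
    class of smooth maps is closed under composition and contains the continuous
    bilinear maps ([class_C_comp], [class_C_bilinear]), hence the matrix product.
    Finally the cancellation in the curvature is the symmetry of
    the second differential of a map between normed spaces
    ([second_differential_sym]), which follows from a mean value inequality for
    vector valued functions. *)

(** * Mean value inequality and symmetry of second differentials *)

Lemma diff_near0 (R : realType) (E F : normedModType R) (f : E -> F) (x : E)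
    (e : R) : differentiable f x -> 0 < e ->
  \forall h \near 0, `|f (x + h) - f x - 'd f x h| <= e * `|h|.
Proof.
move=> /diff_locallyP[_ fE] e0.
have /eqaddoP/(_ _ e0) := fE.
by apply: filterS => h; rewrite !fctE /= opprD addrA [h + x]addrC.
Qed.

(** For each [e > 0] the times at which the bound with slope [M + e] holds form a
    set whose supremum [c] belongs to it, by differentiability at [c] from the
    left; differentiability from the right would push it beyond [c] if [c < 1]. *)
Lemma mean_value_inequality (R : realType) (F : normedModType R)
    (k : R^o -> F) (M : R) :
  (forall t, 0 <= t <= 1 -> derivable k t 1 /\ `|'D_1 k t| <= M) ->
  `|k 1 - k 0| <= M.
Proof.
move=> kM; apply/ler_addgt0Pr => e e0.
pose S := [set t : R | 0 <= t <= 1 /\ `|k t - k 0| <= (M + e) * t].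
have S0 : S 0 by split; rewrite ?lexx ?ler01 // subrr normr0 mulr0.
have Sub : ubound S 1 by move=> t [/andP[]].
have hS : has_sup S by split; [exists 0|exists 1].
set c := sup S.
have c01 : 0 <= c <= 1 by rewrite ub_le_sup //=; [apply: ge_sup => //; exists 0|exists 1].
have [kc Mc] := kM _ c01.
have near_c : \forall h \near (0 : R^o), `|k (c + h) - k c| <= (M + e) * `|h|.
  have dk : differentiable k c by apply/derivable1_diffP.
  have := diff_near0 dk e0; apply: filterS => h kh.
  rewrite -[k (c + h) - k c](subrK ('d k c h)) (le_trans (ler_normD _ _)) //.
  rewrite addrC mulrDl lerD //.
  have -> : 'd k c h = h *: 'D_1 k c.
    by rewrite deriveE // -linearZ /= [_ *: 1]mulr1.
  by rewrite normrZ mulrC ler_wpM2r.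
move/nbhs_ballP : near_c => [d /= d0 near_c].
have Sc : S c.
  split=> //.
  have [s Ss cs] := sup_adherent d0 hS.
  have sc : s <= c by apply: ub_le_sup => //; exists 1.
  have /near_c : ball (0 : R^o) d (s - c).
    rewrite -ball_normE /= sub0r normrN distrC ger0_norm ?subr_ge0 //.
    by rewrite ltrBlDl -ltrBlDr.
  rewrite (addrC c) subrK distrC [`|s - c|]distrC [`|c - s|]ger0_norm ?subr_ge0 // => ksc.
  have -> : k c - k 0 = (k c - k s) + (k s - k 0) by rewrite addrA subrK.
  rewrite (le_trans (ler_normD _ _)) // (le_trans (lerD ksc (proj2 Ss))) //.
  by rewrite -mulrDr subrK.
suff c1 : c = 1 by have [_] := Sc; rewrite c1 mulr1.
apply/eqP; rewrite eq_le; case/andP: c01 => c0 -> /=; rewrite leNgt.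
apply/negP => c1.
pose h := Num.min (d / 2) (1 - c).
have h0 : 0 < h by rewrite lt_min divr_gt0 //= subr_gt0.
have /near_c : ball (0 : R^o) d h.
  rewrite -ball_normE /= sub0r normrN gtr0_norm //.
  by rewrite (@le_lt_trans _ _ (d / 2)) ?ge_min ?lexx // ltr_pdivrMr // ltr_pMr // ltr1n.
rewrite gtr0_norm // => kh.
have : S (c + h).
  split.
    rewrite addr_ge0 //= ?(ltW h0) // addrC -lerBrDr.
    by rewrite ge_min lexx orbT.
  have -> : k (c + h) - k 0 = (k (c + h) - k c) + (k c - k 0) by rewrite addrA subrK.
  rewrite (le_trans (ler_normD _ _)) // (le_trans (lerD kh (proj2 Sc))) //.
  by rewrite -mulrDr (addrC h).
move=> /(ub_le_sup (ex_intro _ 1 Sub)).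
by rewrite leNgt ltrDl h0.
Qed.

Section SecondDifferential.
Context (R : realType) (E F : normedModType R) (g : E -> F) (x : E).

Let D2 (u v : E) : F := 'd (fun p : E * E => 'd g (p.1) (p.2)) (x, u) (v, 0).

Lemma line_is_derive (y w : E) (t : R) : differentiable g (y + t *: w) ->
  is_derive (t : R^o) (1 : R^o) (fun s : R^o => g (y + s *: w)) ('d g (y + t *: w) w).
Proof.
move=> dg.
have line : is_diff (t : R^o) (fun s : R^o => y + s *: w) ( *:%R^~ w).
  have := is_diffD (is_diff_cst y (t : R^o)) (is_diff_scalel t w).
  by rewrite add0r.
have dgl : is_diff (y + t *: w) g ('d g (y + t *: w)) by apply: differentiableP.
have comp : is_diff (t : R^o) (g \o (fun s : R^o => y + s *: w))
   ('d g (y + t *: w) \o ( *:%R^~ w)) by apply: is_diff_comp.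
apply: DeriveDef; first by apply: diff_derivable; exact: ex_diff.
by rewrite deriveE ?diff_val /= ?scale1r //; exact: ex_diff.
Qed.

(** The second difference minus [t ^+ 2 *: D2 u v] is the increment over [[0, 1]]
    of the function [k] below.  Its derivative compares the differentials
    of [g] at two points at distance [O(t)] from [x], so differentiability of
    [dg u] at [x] makes it [o(t ^+ 2)]. *)
Lemma second_difference_near (u v : E) (e : R) :
  (\forall y \near x, differentiable g y) ->
  differentiable (fun p : E * E => 'd g (p.1) (p.2)) (x, u) -> 0 < e ->
  \forall t \near (0 : R)^'+,
    `|g (x + t *: v + t *: u) - g (x + t *: v) - (g (x + t *: u) - g x)
      - t ^+ 2 *: D2 u v| <= e * t ^+ 2.
Proof.
move=> dg d2g e0.
set F2 := (fun p : E * E => 'd g (p.1) (p.2)) in d2g.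
(* [t * C] bounds the sum of the lengths of the two displacements from [x]. *)
pose C := `|v| + `|u| *+ 2 + 1.
have C0 : 0 < C by rewrite ltr_wpDl // addr_ge0 // mulrn_wge0.
have e'0 : 0 < e / C by rewrite divr_gt0.
have /nbhs_ballP[d1 /= d10 dg1] := dg.
have /nbhs_ballP[d2 /= d20 est] := diff_near0 d2g e'0.
pose d := Num.min d1 d2.
have d0 : 0 < d by rewrite lt_min d10.
have dgw w : `|w| < d -> differentiable g (x + w).
  rewrite lt_min => /andP[wd _]; apply: dg1.
  by rewrite -ball_normE /= opprD addrA subrr sub0r normrN.
pose r w := 'd g (x + w) u - 'd g x u - 'd F2 (x, u) (w, 0).
have rw w : `|w| < d -> `|r w| <= e / C * `|w|.
  rewrite lt_min => /andP[_ wd].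
  have /est : ball (0 : E * E) d2 (w, 0).
    by split; rewrite -ball_normE /= sub0r normrN ?normr0.
  rewrite /r /F2 /= addr0 => h; rewrite (le_trans h) // ler_wpM2l ?(ltW e'0) //.
  by rewrite prod_normE /= normr0 ge_max lexx normr_ge0.
near=> t.
have t0 : 0 < t by near: t; exact: nbhs_right_gt.
have tC : t * C < d.
  by rewrite -ltr_pdivlMr //; near: t; apply: nbhs_right_lt; rewrite divr_gt0.
have smallw (tau : R) : 0 <= tau <= 1 -> `|tau *: (t *: u)| <= t * `|u|.
  case/andP=> tau0 tau1; rewrite !normrZ (ger0_norm tau0) (gtr0_norm t0).
  by rewrite ler_piMl // mulr_ge0 // ltW.
have w1C (tau : R) : 0 <= tau <= 1 ->
    `|t *: v + tau *: (t *: u)| <= t * (`|v| + `|u|).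
  move=> tau01; rewrite (le_trans (ler_normD _ _)) // mulrDr lerD ?smallw //.
  by rewrite normrZ gtr0_norm.
have w1d (tau : R) : 0 <= tau <= 1 -> `|t *: v + tau *: (t *: u)| < d.
  move=> /w1C h; rewrite (le_lt_trans h) // (le_lt_trans _ tC) // ler_pM2l //.
  by have := normr_ge0 u; rewrite /C; lra.
have w2d (tau : R) : 0 <= tau <= 1 -> `|tau *: (t *: u)| < d.
  move=> /smallw h; rewrite (le_lt_trans h) // (le_lt_trans _ tC) // ler_pM2l //.
  by have := normr_ge0 u; have := normr_ge0 v; rewrite /C; lra.
pose k : R^o -> F := fun tau =>
  g (x + t *: v + tau *: (t *: u)) - g (x + tau *: (t *: u)) -
  tau *: (t ^+ 2 *: D2 u v).
have dk (tau : R) : 0 <= tau <= 1 -> is_derive (tau : R^o) (1 : R^o) k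
    (t *: (r (t *: v + tau *: (t *: u)) - r (tau *: (t *: u)))).
  move=> tau01.
  have d1k : differentiable g (x + t *: v + tau *: (t *: u)).
    by rewrite -addrA; apply: dgw; exact: w1d.
  have d2k : differentiable g (x + tau *: (t *: u)).
    by apply: dgw; exact: w2d.
  have i1 := line_is_derive d1k.
  have i2 := line_is_derive d2k.
  have i3 : is_derive (tau : R^o) (1 : R^o)
      (fun s : R^o => s *: (t ^+ 2 *: D2 u v)) (t ^+ 2 *: D2 u v).
    have df : is_diff (tau : R^o) ( *:%R^~ (t ^+ 2 *: D2 u v))
      ( *:%R^~ (t ^+ 2 *: D2 u v)) by exact: is_diff_scalel.
    apply: DeriveDef; first by apply: diff_derivable; exact: ex_diff.
    by rewrite deriveE ?diff_val /= ?scale1r //; exact: ex_diff.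
  have i4 := is_deriveB (is_deriveB i1 i2) i3.
  apply: is_derive_eq; rewrite /r addrA.
  have -> : 'd F2 (x, u) (t *: v + tau *: (t *: u), 0) =
     t *: D2 u v + 'd F2 (x, u) (tau *: (t *: u), 0).
    have -> : (t *: v + tau *: (t *: u), 0 : E) =
       t *: (v, 0 : E) + (tau *: (t *: u), 0 : E).
      by congr pair => /=; rewrite scaler0 addr0.
    by rewrite linearD linearZ.
  have L y : 'd g y (t *: u) = t *: 'd g y u by rewrite linearZ.
  rewrite !L expr2 -scalerA -!scalerBr; congr (_ *: _).
  set a := 'd g _ u; set b := 'd g _ u; set c := 'd g _ u.
  set f := 'd F2 _ _; set h := t *: _.
  rewrite [in RHS]opprB [in RHS](addrC f) addrACA opprB (addrA (a - c)) subrK.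
  by rewrite opprD -(addrA (- h)) addNr addr0.
have bk (tau : R) : 0 <= tau <= 1 -> derivable k tau 1 /\ `|'D_1 k tau| <= e * t ^+ 2.
  move=> tau01; have dk' := dk _ tau01; split; first exact: ex_derive.
  rewrite derive_val normrZ gtr0_norm // expr2 mulrA [e * t]mulrC -mulrA ler_pM2l //.
  rewrite (le_trans (ler_normB _ _)) //.
  rewrite (le_trans (lerD (rw _ (w1d _ tau01)) (rw _ (w2d _ tau01)))) //.
  rewrite -mulrDr mulrAC -mulrA ler_pM2l // ler_pdivrMr //.
  rewrite (le_trans (lerD (w1C _ tau01) (smallw _ tau01))) // -mulrDr ler_pM2l //.
  by rewrite /C; lra.
have := mean_value_inequality bk.
rewrite /k !scale1r !scale0r !addr0 subr0; congr (`|_| <= _).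
rewrite [LHS]addrAC; congr (_ - _); rewrite !opprB.
by rewrite [in LHS](addrC (g x)) addrACA (addrC (- _)).
Unshelve. all: by end_near.
Qed.

(** Exchanging [u] and [v] does not change the second difference, so both sides
    are its limit after division by [t ^+ 2]. *)
Lemma second_differential_sym (u v : E) :
  (\forall y \near x, differentiable g y) ->
  (forall w, differentiable (fun p : E * E => 'd g (p.1) (p.2)) (x, w)) ->
  D2 u v = D2 v u.
Proof.
move=> dg d2g; apply/eqP; rewrite -subr_eq0 -normr_le0.
apply/ler_addgt0Pr => e e0; rewrite add0r.
have e2 : 0 < e / 2 by rewrite divr_gt0.
have N1 := second_difference_near v dg (d2g u) e2.
have N2 := second_difference_near u dg (d2g v) e2.
near (0 : R)^'+ => t.
have t0 : 0 < t by near: t; exact: nbhs_right_gt.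
have t20 : 0 < t ^+ 2 by rewrite exprn_gt0.
rewrite -(ler_pM2l t20) -[X in X * `|_|](gtr0_norm t20) -normrZ scalerBr.
set a := g (x + t *: v + t *: u) - g (x + t *: v) - (g (x + t *: u) - g x).
have h1 : `|a - t ^+ 2 *: D2 u v| <= e / 2 * t ^+ 2.
  by rewrite /a; near: t.
have h2 : `|a - t ^+ 2 *: D2 v u| <= e / 2 * t ^+ 2.
  have -> : a = g (x + t *: u + t *: v) - g (x + t *: u) - (g (x + t *: v) - g x).
    rewrite /a (addrAC x) !opprB.
    by rewrite [in LHS](addrC (g x)) addrACA (addrC (- _)).
  by near: t.
have -> : t ^+ 2 *: D2 u v - t ^+ 2 *: D2 v u =
    (a - t ^+ 2 *: D2 v u) - (a - t ^+ 2 *: D2 u v).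
  by rewrite opprB addrC [in RHS]addrC addrA subrK addrC.
rewrite (le_trans (ler_normB _ _)) // (le_trans (lerD h2 h1)) //.
by rewrite -mulrDl -splitr mulrC.
Unshelve. all: by end_near.
Qed.

End SecondDifferential.

(** * Closure properties of the classes C^n *)

Section ClassC.
Context {R : realType}.
Implicit Types E F G : normedModType R.

Lemma near_eq_is_diff E F (f g : E -> F) (x : E) :
  (\forall y \near x, f y = g y) -> differentiable f x -> is_diff x g ('d f x).
Proof.
move=> fg df.
have gE : g \o shift x = cst (g x) + 'd f x +o_ 0 id.
  have /diff_locally/eqaddoP fE := df.
  apply/eqaddoP => e e0; have := fE _ e0.
  have : \forall h \near (0 : E), f (h + x) = g (h + x).
    by move: fg; rewrite (near_shift 0) /= subr0.
  apply: filterS2 => h fgh; rewrite !fctE /= fgh /cst.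
  by rewrite (nbhs_singleton fg).
have dg : 'd g x = 'd f x :> (E -> F) by apply: diff_unique gE; exact: diff_continuous.
split=> //; apply/diff_locallyP; rewrite dg; split=> //; exact: diff_continuous.
Qed.

Lemma open_cylinder E F (U : set E) : open U -> open (U `*` [set: F]).
Proof.
move=> oU; have -> : U `*` [set: F] = fst @^-1` U.
  by apply/seteqP; split=> -[x y] //= [].
by apply: open_comp => // p _; exact: cvg_fst.
Qed.

Lemma class_C_eq n E F (U : set E) (f g : E -> F) :
  open U -> (forall x, U x -> f x = g x) -> class_C n U f -> class_C n U g.
Proof.
elim: n E F U f g => [|n IH] E F U f g oU fg /=.
  move=> Cf x Ux; have near_fg : \forall y \near x, f y = g y.
    by apply: filterS fg _; exact: open_nbhs_nbhs.
  have fx : f @ x --> f x := Cf x Ux.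
  suff gx : g @ x --> f x by rewrite /prop_for /continuous_at -fg.
  by apply: cvg_trans fx; exact: near_eq_cvg near_fg.
move=> [df Cdf].
have dg x : U x -> is_diff x g ('d f x).
  move=> Ux; apply: near_eq_is_diff; last exact: df.
  by apply: filterS fg _; exact: open_nbhs_nbhs.
split; first by move=> x /dg[].
apply: IH Cdf; first by exact: open_cylinder.
by move=> [x v] /= [Ux _]; have [_ ->] := dg _ Ux.
Qed.

Lemma class_C_sub n E F (U V : set E) (f : E -> F) :
  V `<=` U -> class_C n U f -> class_C n V f.
Proof.
elim: n E F U V f => [|n IH] E F U V f VU /=; first by move=> Cf x /VU /Cf.
move=> [df Cdf]; split; first by move=> x /VU /df.
by apply: IH Cdf => -[x v] /= [/VU].
Qed.

Lemma class_C_pred n E F (U : set E) (f : E -> F) :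
  class_C n.+1 U f -> class_C n U f.
Proof.
elim: n E F U f => [|n IH] E F U f.
  by move=> [df _] x Ux; exact: differentiable_continuous (df _ Ux).
by move=> [df Cdf]; split=> //; exact: IH.
Qed.

Lemma class_C_pair n E F G (U : set E) (f : E -> F) (g : E -> G) : open U ->
  class_C n U f -> class_C n U g -> class_C n U (fun x => (f x, g x)).
Proof.
elim: n E F G U f g => [|n IH] E F G U f g oU /=.
  by move=> Cf Cg x Ux; apply: cvg_pair; [exact: Cf|exact: Cg].
move=> [df Cdf] [dg Cdg]; split.
  by move=> x Ux; apply: differentiable_pair; [exact: df|exact: dg].
have oUT : open (U `*` [set: E]) by exact: open_cylinder.
apply: class_C_eq (IH _ _ _ _ _ _ oUT Cdf Cdg) => // -[x v] /= [Ux _].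
by rewrite diff_pair //; [exact: df|exact: dg].
Qed.

Lemma class_C_linear n E F (U : set E) (f : {linear E -> F}) :
  open U -> continuous f -> class_C n U f.
Proof.
elim: n E F U f => [|n IH] E F U f oU cf /=; first by move=> x _; exact: cf.
split; first by move=> x _; exact: linear_differentiable.
have oUT : open (U `*` [set: E]) by exact: open_cylinder.
apply: (@class_C_eq _ _ _ _ (f \o snd)) => //.
  by move=> [x v] _ /=; rewrite diff_lin.
by apply: IH => // p; apply: continuous_comp; [exact: cvg_snd|exact: cf].
Qed.

Lemma class_C_cst n E F (U : set E) (a : F) : open U -> class_C n U (cst a).
Proof.
elim: n E F U a => [|n IH] E F U a oU /=; first by move=> x _; exact: cst_continuous.
split; first by move=> x _; exact: differentiable_cst.
have oUT : open (U `*` [set: E]) by exact: open_cylinder.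
by apply: (class_C_eq oUT _ (IH _ _ _ 0 oUT)) => -[x v] _ /=; rewrite diff_cst.
Qed.

(** The differential of [g \o f], as a function of a point and a vector, is the
    differential of [g] composed with [(x, v) |-> (f x, df x v)]: the
    induction on [n] applies to this composition, on other spaces. *)
Lemma class_C_comp n E F G (U : set E) (V : set F) (f : E -> F) (g : F -> G) :
  open U -> (forall x, U x -> V (f x)) -> class_C n U f -> class_C n V g ->
  class_C n U (g \o f).
Proof.
elim: n E F G U V f g => [|n IH] E F G U V f g oU fUV.
  by move=> Cf Cg x Ux; apply: continuous_comp; [exact: Cf|exact: Cg (fUV _ Ux)].
move=> Cf [dg Cdg]; have [df Cdf] := Cf; split.
  by move=> x Ux; apply: differentiable_comp; [exact: df|exact: dg (fUV _ Ux)].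
have oUT : open (U `*` [set: E]) by exact: open_cylinder.
have Cf1 : class_C n (U `*` [set: E]) (f \o fst).
  apply: (IH _ _ _ _ U) => //; first by move=> [x v] [].
    by apply: class_C_linear => // p; exact: cvg_fst.
  exact: class_C_pred.
apply: (@class_C_eq _ _ _ _
    ((fun p => 'd g (p.1) (p.2)) \o (fun p => (f p.1, 'd f (p.1) p.2)))) => //.
  move=> [x v] [/= Ux _]; by rewrite (diff_comp (df _ Ux) (dg _ (fUV _ Ux))).
apply: (IH _ _ _ _ (V `*` [set: F])) => //; last exact: class_C_pair.
by move=> [x v] [/= /fUV].
Qed.

Lemma class_C_add n E F (U : set E) (f g : E -> F) : open U ->
  class_C n U f -> class_C n U g -> class_C n U (fun x => f x + g x).
Proof.
move=> oU Cf Cg.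
pose add (p : F * F) : F := p.1 + p.2.
have addL : linear add.
  by move=> k p q; rewrite /add /= scalerDr addrACA.
pose addM := GRing.isLinear.Build _ _ _ _ _ addL.
pose addl : {linear _ -> _} := HB.pack add addM.
have Ca : class_C n setT addl.
  apply: class_C_linear; first exact: openT.
  by move=> p; apply: cvgD; [exact: cvg_fst|exact: cvg_snd].
exact: (class_C_comp oU _ (class_C_pair oU Cf Cg) Ca).
Qed.

(** The differential of [b] is a sum of two copies of [b], each precomposed with
    linear coordinate maps, so the induction hypothesis for [b] itself applies. *)
Lemma class_C_bilinear n E F G (U : set (E * F)) (b : {bilinear E -> F -> G}) :
  open U -> continuous (fun p => b p.1 p.2) ->
  class_C n U (fun p => b p.1 p.2).
Proof.
move=> + cb; elim: n U => [|n IH] U oU; first by move=> p _; exact: cb.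
split; first by move=> p _; exact: differentiable_bilin.
have oUT : open (U `*` [set: E * F]) by exact: open_cylinder.
apply: (@class_C_eq _ _ _ _
  (fun p : (E * F) * (E * F) => b p.1.1 p.2.2 + b p.2.1 p.1.2)) => //.
  by move=> [p v] _ /=; rewrite diff_bilin.
have CT := IH _ openT.
apply: class_C_add => //.
- apply: (class_C_comp oUT (f := fun p => (p.1.1, p.2.2)) _ _ CT) => //.
  apply: class_C_pair => //.
    by apply: (@class_C_linear _ _ _ _ (fst \o fst)) => // p;
      apply: continuous_comp; solve [exact: cvg_fst|exact: cvg_snd].
  by apply: (@class_C_linear _ _ _ _ (snd \o snd)) => // p;
      apply: continuous_comp; solve [exact: cvg_fst|exact: cvg_snd].
- apply: (class_C_comp oUT (f := fun p => (p.2.1, p.1.2)) _ _ CT) => //.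
  apply: class_C_pair => //.
    by apply: (@class_C_linear _ _ _ _ (fst \o snd)) => // p;
      apply: continuous_comp; solve [exact: cvg_fst|exact: cvg_snd].
  by apply: (@class_C_linear _ _ _ _ (snd \o fst)) => // p;
      apply: continuous_comp; solve [exact: cvg_fst|exact: cvg_snd].
Qed.

End ClassC.

(** * Matrices over a C*-algebra as a Banach algebra *)

Section MatrixNorm.
Context {R : realType} {A : cstarAlgType R}.
Implicit Types a b : A.

Lemma cnormr0 : cnorm (0 : A) = 0.
Proof.
by have := cnormZ (0 : R[i]) (0 : A); rewrite scale0r normr0 mul0r => /complexI.
Qed.

Lemma cnorm_ge0 a : 0 <= cnorm a.
Proof.
have N : cnorm (- a) = cnorm a.
  by have := cnormZ (- 1 : R[i]) a; rewrite normrN1 mul1r scaleN1r => /complexI.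
by have := cnormD a (- a); rewrite subrr cnormr0 N -mulr2n pmulrn_lge0.
Qed.

Lemma cnorm_cstar a : cnorm (cstar a) = cnorm a.
Proof.
have le b : cnorm b <= cnorm (cstar b).
  have [/eqP->|b0] := boolP (cnorm b == 0); first exact: cnorm_ge0.
  have bp : 0 < cnorm b by rewrite lt_def b0 cnorm_ge0.
  by rewrite -(ler_pM2r bp) -expr2 -cnorm_cstarM cnormM.
by apply/eqP; rewrite eq_le le -[X in cnorm _ <= cnorm X]cstarK le.
Qed.

Lemma rmatrix_normE m n (M : rmatrix A m n) :
  `|M| = \sum_(i < m) \sum_(j < n) cnorm ((M : 'M[A]_(m, n)) i j).
Proof. by []. Qed.

Lemma cnorm_entry m n (M : 'M[A]_(m, n)) i j :
  cnorm (M i j) <= `|M : rmatrix A m n|.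
Proof.
rewrite rmatrix_normE (bigD1 i) //= (bigD1 j) //= -addrA lerDl.
by rewrite addr_ge0 ?sumr_ge0 // => *; rewrite ?sumr_ge0 // => *; exact: cnorm_ge0.
Qed.

Lemma cnorm_sum (I : Type) (s : seq I) (F : I -> A) :
  cnorm (\sum_(i <- s) F i) <= \sum_(i <- s) cnorm (F i).
Proof.
elim: s => [|i s IH]; first by rewrite !big_nil cnormr0.
by rewrite !big_cons (le_trans (cnormD _ _)) // lerD2l.
Qed.

Lemma norm_mulmx m n p (M : 'M[A]_(m, n)) (N : 'M[A]_(n, p)) :
  `|M *m N : rmatrix A m p| <= `|M : rmatrix A m n| * `|N : rmatrix A n p|.
Proof.
rewrite !rmatrix_normE mulr_suml; apply: ler_sum => i _.
have -> : (\sum_(j < n) cnorm (M i j)) * (\sum_(j < n) \sum_(k < p) cnorm (N j k))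
   = \sum_(k < p) \sum_(j < n) (\sum_(l < n) cnorm (M i l)) * cnorm (N j k).
  by rewrite mulr_sumr exchange_big; apply: eq_bigr => j _; rewrite mulr_sumr.
apply: ler_sum => k _; rewrite mxE (le_trans (cnorm_sum _ _)) //.
apply: ler_sum => j _; rewrite (le_trans (cnormM _ _)) // ler_wpM2r ?cnorm_ge0 //.
rewrite (bigD1 j) //= lerDl sumr_ge0 // => *; exact: cnorm_ge0.
Qed.

Lemma norm_starmx m n (M : 'M[A]_(m, n)) :
  `|starmx M : rmatrix A n m| = `|M : rmatrix A m n|.
Proof.
rewrite !rmatrix_normE exchange_big; apply: eq_bigr => i _; apply: eq_bigr => j _.
by rewrite mxE cnorm_cstar.
Qed.

Lemma rmatrix_complete m n (u : nat -> rmatrix A m n) :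
  (forall e, 0 < e -> exists N, forall k l, (N <= k)%N -> (N <= l)%N ->
     `|u k - u l| < e) ->
  exists l : rmatrix A m n, forall e, 0 < e -> \forall k \near \oo, `|u k - l| <= e.
Proof.
move=> cu.
have /choice[l lP] (ij : 'I_m * 'I_n) : exists l : A,
    cnorm ((u k : 'M[A]_(m, n)) ij.1 ij.2 - l) @[k --> \oo] --> (0 : R).
  apply: cnorm_complete => e /cu[N uN]; exists N => k1 k2 Nk1 Nk2.
  rewrite (le_lt_trans _ (uN _ _ Nk1 Nk2)) //.
  by have := cnorm_entry (u k1 - u k2 : 'M[A]_(m, n)) ij.1 ij.2; rewrite !mxE.
pose L : 'M[A]_(m, n) := \matrix_(i, j) l (i, j).
exists L => e e0.
suff : `|u k - (L : rmatrix A m n)| @[k --> \oo] --> (0 : R).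
  move=> /cvgr0Pnorm_le /(_ _ e0).
  by apply: filterS => k; rewrite normr_id.
have H : \sum_(i < m) \sum_(j < n) cnorm ((u k - L : 'M[A]_(m, n)) i j)
    @[k --> \oo] --> \sum_(i < m) \sum_(j < n) (0 : R).
  apply: cvg_big => [p|i _]; first exact: add_continuous.
  apply: cvg_big => [p|j _]; first exact: add_continuous.
  by under eq_fun do rewrite !mxE; exact: (lP (i, j)).
by rewrite big1 in H => // i _; rewrite big1.
Qed.

End MatrixNorm.

Section Neumann.
Context {R : realType} {A : cstarAlgType R}.
Implicit Types M L : 'M[A]_2.

Local Notation nrm M := (`|M : rmatrix A 2 2|).

Lemma neumann_inverse M : nrm M <= 1 / 2 ->
  exists L, L *m (1%:M - M) = 1%:M /\ (1%:M - M) *m L = 1%:M.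
Proof.
move=> M2; pose N1 := nrm (1%:M : 'M[A]_2).
have N10 : 0 <= N1 by exact: normr_ge0.
have powM k : nrm (M ^+ k) <= N1 * (1 / 2) ^+ k.
  elim: k => [|k IH]; first by rewrite expr0 expr0 mulr1 lexx.
  rewrite exprSr (le_trans (norm_mulmx _ _)) // (exprSr (1 / 2)) [leRHS]mulrA.
  by rewrite ler_pM ?normr_ge0.
(* The inverse is the limit of the partial sums of the geometric series. *)
pose u k : 'M[A]_2 := \sum_(i < k) M ^+ i.
have Mu k : (1%:M - M) *m u k = 1%:M - M ^+ k.
  have := subrX1 M k; rewrite -/(u k) => h.
  by rewrite -opprB -[RHS]opprB [in RHS]h mulNmx.
have uM k : u k *m (1%:M - M) = 1%:M - M ^+ k.
  rewrite -Mu; apply: commr_sym; apply: commr_sum => i _.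
  by apply: commr_sym; apply: commrB; [exact: commr1|exact/commr_sym/commrX].
have du k d : nrm (u (k + d)%N - u k) <= N1 * (1 / 2) ^+ k * (2 - 2 * (1 / 2) ^+ d).
  elim: d => [|d IH]; first by rewrite addn0 subrr normr0 expr0 mulr1 subrr mulr0.
  rewrite addnS /u big_ord_recr /= -/(u _) -/(u _) addrAC.
  rewrite (le_trans (ler_normD _ _)) // (le_trans (lerD IH (powM _))) //.
  by rewrite exprD exprSr le_eqVlt; apply/orP; left; apply/eqP; field.
have small (C e : R) : 0 < e -> \forall k \near \oo, C * (1 / 2) ^+ k < e.
  move=> e0.
  have /cvg_geometric : `|1 / 2 : R| < 1 by rewrite ger0_norm; lra.
  move=> /(_ C) /cvgr0Pnorm_lt /(_ _ e0).
  by apply: filterS => k; apply: le_lt_trans; exact: ler_norm.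
have bound k d : nrm (u (k + d)%N - u k) <= N1 * 2 * (1 / 2) ^+ k.
  rewrite (le_trans (du _ _)) // mulrAC ler_wpM2r ?exprn_ge0 ?divr_ge0 //.
  by rewrite ler_wpM2l // gerBl mulr_ge0 ?exprn_ge0 ?divr_ge0.
have [e e0|L uL] := @rmatrix_complete R A 2 2 u.
  have [N _ Ne] := small (N1 * 4) _ e0.
  have {}Ne := Ne N (leqnn N); exists N => k l Nk Nl.
  have -> : u k - u l = (u (N + (k - N))%N - u N) - (u (N + (l - N))%N - u N).
    by rewrite !subnKC // opprB addrA subrK.
  rewrite (le_lt_trans (ler_normB _ _)) //.
  rewrite (le_lt_trans (lerD (bound _ _) (bound _ _))) //.
  by apply: le_lt_trans Ne; rewrite le_eqVlt; apply/orP; left; apply/eqP; field.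
have lim0 (P : 'M[A]_2) (C : R) :
    (forall k, nrm P <= C * nrm (u k - L) + N1 * (1 / 2) ^+ k) -> P = 0.
  move=> PC; suff : nrm P <= 0 by rewrite normr_le0 => /eqP.
  apply/ler_addgt0Pr => e e0; rewrite add0r.
  have C1 : 0 < `|C| + 1 by rewrite ltr_wpDl.
  have eC : 0 < e / 2 / (`|C| + 1) by rewrite !divr_gt0.
  have e2 : 0 < e / 2 by rewrite divr_gt0.
  near \oo => k.
  have h1 : nrm (u k - L) <= e / 2 / (`|C| + 1) by near: k; exact: uL.
  have h2 : N1 * (1 / 2) ^+ k < e / 2 by near: k; exact: small.
  rewrite (le_trans (PC k)) // [leRHS]splitr lerD ?(ltW h2) //.
  rewrite (le_trans (ler_wpM2r _ (ler_norm _))) //.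
  rewrite (@le_trans _ _ ((`|C| + 1) * nrm (u k - L))) ?ler_wpM2r ?lerDl //.
  by rewrite mulrC -ler_pdivlMr.
exists L; split; apply: subr0_eq.
  apply: (lim0 _ (nrm (1%:M - M))) => k.
  have -> : L *m (1%:M - M) - 1%:M = - ((u k - L) *m (1%:M - M) + M ^+ k).
    by rewrite mulmxBl uM addrAC subrK opprB.
  rewrite normrN (le_trans (ler_normD _ _)) // lerD ?powM //.
  by rewrite mulrC norm_mulmx.
apply: (lim0 _ (nrm (1%:M - M))) => k.
have -> : (1%:M - M) *m L - 1%:M = - ((1%:M - M) *m (u k - L) + M ^+ k).
  by rewrite mulmxBr Mu addrAC subrK opprB.
rewrite normrN (le_trans (ler_normD _ _)) // lerD ?powM //.
exact: norm_mulmx.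
Unshelve. all: by end_near.
Qed.

End Neumann.

(** * The indefinite form and its adjunction *)

Section StarMatrix.
Context {R : realType} {A : cstarAlgType R}.

Lemma cstar0 : cstar (0 : A) = 0.
Proof. by have := cstarD (0 : A) 0; rewrite addr0 -{1}[cstar 0]addr0 => /addrI. Qed.

Lemma cstarN (a : A) : cstar (- a) = - cstar a.
Proof. by apply/eqP; rewrite -addr_eq0 -cstarD addNr cstar0. Qed.

Lemma cstar1 : cstar (1 : A) = 1.
Proof. by rewrite -[LHS]mulr1 -[X in _ * X]cstarK -cstarM mulr1 cstarK. Qed.

Lemma cstar_sum (I : Type) (s : seq I) (F : I -> A) :
  cstar (\sum_(i <- s) F i) = \sum_(i <- s) cstar (F i).
Proof. exact: (big_morph _ cstarD cstar0). Qed.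

Lemma alg_central (z : R[i]) (a : A) : a * z%:A = z%:A * a.
Proof. by rewrite -scalerAr -scalerAl mulr1 mul1r. Qed.

Lemma cstar_alg (z : R[i]) : cstar (z%:A : A) = (conjc z)%:A.
Proof. by rewrite cstarZ cstar1. Qed.

Lemma starmxD m n (M N : 'M[A]_(m, n)) : starmx (M + N) = starmx M + starmx N.
Proof. by apply/matrixP => i j; rewrite !mxE cstarD. Qed.

Lemma starmxN m n (M : 'M[A]_(m, n)) : starmx (- M) = - starmx M.
Proof. by apply/matrixP => i j; rewrite !mxE cstarN. Qed.

Lemma starmxK m n (M : 'M[A]_(m, n)) : starmx (starmx M) = M.
Proof. by apply/matrixP => i j; rewrite !mxE cstarK. Qed.

Lemma starmxM m n p (M : 'M[A]_(m, n)) (N : 'M[A]_(n, p)) :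
  starmx (M *m N) = starmx N *m starmx M.
Proof.
apply/matrixP => i j; rewrite !mxE cstar_sum; apply: eq_bigr => k _.
by rewrite !mxE cstarM.
Qed.

Lemma starmx_scalar n (a : A) : starmx (a%:M : 'M[A]_n) = (cstar a)%:M.
Proof.
by apply/matrixP => i j; rewrite !mxE eq_sym; case: eqP => _;
  rewrite ?mulr1n ?mulr0n ?cstar0.
Qed.

Lemma starmx_rho : starmx (rho A) = rho A.
Proof.
apply/matrixP => i j; rewrite !mxE eq_sym; case: eqP => [->|_].
  rewrite !mulr1n; elim: (nat_of_ord j) => [|k IH]; first by rewrite expr0 cstar1.
  by rewrite {1}exprSr cstarM IH cstarN cstar1 -exprS.
by rewrite !mulr0n cstar0.
Qed.

Lemma rhoK : rho A *m rho A = 1%:M.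
Proof.
apply/matrixP => i j; rewrite !mxE !big_ord_recl big_ord0 !mxE.
by case: i j => [[|[|i]] //= Hi] [[|[|j]] //= Hj];
  rewrite ?mulr1n ?mulr0n ?expr0 ?expr1 ?mulr1 ?mulr0 ?mul0r ?mulrNN ?addr0 ?add0r ?mulr1.
Qed.

Implicit Types (M N q X Y m : 'M[A]_2) (v w x y : 'cV[A]_2).

Lemma sharpD M N : sharp (M + N) = sharp M + sharp N.
Proof. by rewrite /sharp starmxD mulmxDr mulmxDl. Qed.

Lemma sharpN M : sharp (- M) = - sharp M.
Proof. by rewrite /sharp starmxN mulmxN mulNmx. Qed.

Lemma sharpM M N : sharp (M *m N) = sharp N *m sharp M.
Proof.
by rewrite /sharp starmxM !mulmxA -(mulmxA _ (rho A) (rho A)) rhoK mulmx1.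
Qed.

Lemma sharpK M : sharp (sharp M) = M.
Proof.
by rewrite /sharp !starmxM starmx_rho starmxK !mulmxA rhoK mul1mx -mulmxA rhoK mulmx1.
Qed.

Lemma sharp1 : sharp (1%:M : 'M[A]_2) = 1%:M.
Proof. by rewrite /sharp starmx_scalar cstar1 mulmx1 rhoK. Qed.

Lemma theta_sharp M v w : theta v (M *m w) = theta (sharp M *m v) w.
Proof.
rewrite /theta /sharp !starmxM !starmx_rho starmxK !mulmxA.
by rewrite -(mulmxA _ (rho A) (rho A)) rhoK mulmx1.
Qed.

Lemma theta_star v w : cstar (theta v w) = theta w v.
Proof.
have -> : theta w v = starmx (starmx v *m rho A *m w) 0 0.
  by rewrite !starmxM starmx_rho starmxK mulmxA.
by rewrite mxE.
Qed.

Lemma starmx_rho_mul v w : starmx v *m rho A *m w = (theta v w)%:M.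
Proof. by rewrite [LHS]mx11_scalar. Qed.

Lemma theta_rmulr v w b : theta v (rmul w b) = theta v w * b.
Proof. by rewrite /theta /rmul !mulmxA [LHS]mxE big_ord1 [X in _ * X]mxE eqxx mulr1n. Qed.

(** [m] maps [R(q)] and [N(q)] onto the range and the nullspace of the conjugate
    and preserves [theta], so the two sign conditions are transported. *)
Lemma unitary_conj_Qrho m q : unitary_theta m -> Qrho q ->
  Qrho (m *m q *m sharp m).
Proof.
(* [sharp m] is a product of three matrices: it is abstracted so that
   associativity does not look inside it. *)
rewrite /unitary_theta; have := sharpK m; move sE : (sharp m) => m' m'E.
move=> [mm' m'm] [qq q' qpos qneg]; split.
- by rewrite !mulmxA -(mulmxA _ m' m) m'm mulmx1 -(mulmxA _ q q) qq.
- by rewrite !sharpM sE m'E q' mulmxA.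
- move=> v [w ->]; rewrite -!mulmxA theta_sharp sE !mulmxA m'm mul1mx.
  by apply: qpos; exists (m' *m w); rewrite mulmxA.
- move=> v mv; have := qneg (m' *m v).
  rewrite theta_sharp m'E !mulmxA mm' mul1mx; apply.
  have : m' *m (m *m q *m m' *m v) = 0 by rewrite mv mulmx0.
  by rewrite /null_of /= !mulmxA m'm mul1mx.
Qed.

End StarMatrix.

Section ComplexScale.
Context {R : realType} {A : cstarAlgType R}.
Implicit Types (z w : R[i]).

Lemma complex_scaleA (V : lmodType A) z w (v : V) :
  complex_scale z (complex_scale w v) = complex_scale (z * w) v.
Proof. by rewrite /complex_scale scalerA -scalerAl mul1r scalerA. Qed.

Lemma complex_scaleDr (V : lmodType A) z (u v : V) :
  complex_scale z (u + v) = complex_scale z u + complex_scale z v.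
Proof. exact: scalerDr. Qed.

Lemma complex_scaleDl (V : lmodType A) z w (v : V) :
  complex_scale (z + w) v = complex_scale z v + complex_scale w v.
Proof. by rewrite /complex_scale !scalerDl. Qed.

Lemma complex_scaleN (V : lmodType A) z (v : V) :
  complex_scale z (- v) = - complex_scale z v.
Proof. exact: scalerN. Qed.

Lemma complex_scale1 (V : lmodType A) (v : V) : complex_scale 1 v = v.
Proof. by rewrite /complex_scale !scale1r. Qed.

Lemma complex_scale_mulmxl m n p z (M : 'M[A]_(m, n)) (N : 'M[A]_(n, p)) :
  complex_scale z M *m N = complex_scale z (M *m N).
Proof. by rewrite /complex_scale scalemxAl. Qed.

(** Unlike scaling on the left of a product, this uses that [z%:A] is central. *)
Lemma complex_scale_mulmxr m n p z (M : 'M[A]_(m, n)) (N : 'M[A]_(n, p)) :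
  M *m complex_scale z N = complex_scale z (M *m N).
Proof.
apply/matrixP => i j; rewrite !mxE mulr_sumr; apply: eq_bigr => k _.
by rewrite !mxE !mulrA alg_central.
Qed.

Lemma sharp_complex_scale z (M : 'M[A]_2) :
  sharp (complex_scale z M) = complex_scale (conjc z) (sharp M).
Proof.
have h : starmx (complex_scale z M) = complex_scale (conjc z) (starmx M).
  by apply/matrixP => i j; rewrite !mxE cstarM cstar_alg alg_central.
by rewrite /sharp h complex_scale_mulmxr complex_scale_mulmxl.
Qed.

End ComplexScale.

(** * Curves in the manifold with prescribed velocity *)

Section Curves.
Context {R : realType} {A : cstarAlgType R}.
Implicit Types (M N L S q X : 'M[A]_2).

Local Notation nrm M := (`|M : rmatrix A 2 2|).

Lemma is_derive_quadratic (F : normedModType R) (g : R^o -> F) (v : F) (K : R) :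
  (\forall t \near (0 : R), `|g t - g 0 - t *: v| <= K * t ^+ 2) ->
  is_derive (0 : R^o) (1 : R^o) g v.
Proof.
move=> gK.
have lim : (fun h : R^o => h^-1 *: ((g \o shift (0 : R^o)) (h *: (1 : R^o)) - g 0))
    @ (0 : R^o)^' --> v.
  apply/cvgrPdist_le => e e0.
  have K1 : 0 < `|K| + 1 by rewrite ltr_wpDl.
  near=> h.
  have h0 : h != 0 by near: h; exact: nbhs_dnbhs_neq.
  have -> : (g \o shift (0 : R^o)) (h *: (1 : R^o)) = g h.
    by rewrite /= addr0 [_ *: _]mulr1.
  have hK : `|g h - g 0 - h *: v| <= K * h ^+ 2.
    by near: h; exact: nbhs_dnbhs.
  have -> : v - h^-1 *: (g h - g 0) = - (h^-1 *: (g h - g 0 - h *: v)).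
    by rewrite [in RHS]scalerBr scalerA mulVf // scale1r opprB.
  rewrite normrN normrZ normfV ler_pdivrMl ?normr_gt0 //.
  rewrite (le_trans hK) // -[h ^+ 2]real_normK ?num_real // expr2 mulrCA.
  rewrite ler_pM2l ?normr_gt0 //.
  rewrite (@le_trans _ _ ((`|K| + 1) * `|h|)) //.
    by rewrite ler_wpM2r // (le_trans (ler_norm _)) // lerDl.
  rewrite mulrC -ler_pdivlMr //; near: h; apply: nbhs_dnbhs.
  by apply: (@nbhs0_le _ R^o); rewrite divr_gt0.
split; first by apply/cvg_ex; exists v.
exact: cvg_lim.
Unshelve. all: by end_near. Qed.

Lemma norm_inverse M L : nrm M <= 1 / 2 -> (1%:M - M) *m L = 1%:M ->
  nrm L <= 2 * nrm 1%:M.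
Proof.
move=> M2; rewrite mulmxBl mul1mx => /eqP; rewrite subr_eq => /eqP LE.
have : nrm L <= nrm 1%:M + nrm M * nrm L.
  by rewrite {1}LE (le_trans (ler_normD _ _)) // lerD2l norm_mulmx.
have : nrm M * nrm L <= 1 / 2 * nrm L by rewrite ler_wpM2r.
by move=> h1 h2; lra.
Qed.

Lemma norm_sharp M : nrm (sharp M) <= nrm (rho A) ^+ 2 * nrm M.
Proof.
rewrite /sharp (le_trans (norm_mulmx _ _)) // expr2 mulrAC ler_wpM2r //.
by rewrite (le_trans (norm_mulmx _ _)) // norm_starmx.
Qed.

(** [sharp] turns [1 + S] into [1 - S] and the inverse [L] of [1 - S] into an
    inverse of [1 + S]; all four matrices commute. *)
Lemma cayley_unitary S L : sharp S = - S ->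
  L *m (1%:M - S) = 1%:M -> (1%:M - S) *m L = 1%:M ->
  unitary_theta (L *m (1%:M + S)).
Proof.
move=> skew La aL.
have : sharp L *m (1%:M + S) = 1%:M.
  by rewrite -[S]opprK -skew -sharp1 -sharpN -sharpD -sharpM aL.
have : (1%:M + S) *m sharp L = 1%:M.
  by rewrite -[S]opprK -skew -sharp1 -sharpN -sharpD -sharpM La.
have ab : (1%:M - S) *m (1%:M + S) = (1%:M + S) *m (1%:M - S).
  rewrite !mulmxDl !mulmxDr !mul1mx !mulmx1 mulNmx mulmxN !addrA.
  by rewrite -(addrA 1%:M) (addrC S) addrA.
have sb : sharp (1%:M + S) = 1%:M - S by rewrite sharpD sharp1 skew.
rewrite /unitary_theta sharpM sb; move: (sharp L) => K.
move: ab La aL; move: (1%:M - S) (1%:M + S) => a b ab La aL bK Kb.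
split.
  by rewrite !mulmxA -(mulmxA L) -ab mulmxA La mul1mx bK.
have aK : a *m K = K *m a.
  by rewrite -[a in RHS]mulmx1 -bK (mulmxA a) ab !mulmxA Kb mul1mx.
by rewrite !mulmxA aK -(mulmxA K) aL mulmx1 Kb.
Qed.

Lemma complex_scale_norm (t : R) M : nrm (complex_scale t%:C M) = `|t| * nrm M.
Proof. exact: (normrZ t (M : rmatrix A 2 2)). Qed.

(** When [g] is the conjugate of [q] by the Cayley transform of [S], this exhibits
    the remainder of its first order expansion [q + 2 [S, q]] as a multiple of
    both [S] and [g - q], hence of second order. *)
Lemma cayley_conj_expand S q g :
    (1%:M - S) *m g *m (1%:M + S) = (1%:M + S) *m q *m (1%:M - S) ->
  (g - q) - (S *m q - q *m S) *+ 2 =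
    S *m (g - q) - (g - q) *m S + S *m (g - q) *m S.
Proof.
move=> gE.
have two (V : zmodType) (p r : V) : (p + r) - (p - r) = r *+ 2.
  by rewrite opprB [p + r]addrC addrACA subrr addr0.
have two' (V : zmodType) (p r : V) : (p + r) + (p - r) = p *+ 2.
  by rewrite addrACA subrr addr0.
have : (1%:M - S) *m (g - q) *m (1%:M + S) = (S *m q - q *m S) *+ 2.
  rewrite mulmxBr mulmxBl gE mulmxDl mulmxBl !mul1mx mulmxBr mulmxDr !mulmx1.
  rewrite opprD addrACA two -opprD [(_ + _) *m S]mulmxDl [(_ - _) *m S]mulmxBl two'.
  by rewrite mulrnBl.
move=> <-; set d := g - q.
rewrite mulmxBl mul1mx mulmxDr mulmx1 [(_ - _) *m S]mulmxBl.
rewrite opprD opprB addrA [d + _]addrC subrK.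
by rewrite opprB addrA addrAC.
Qed.

(** [X] exchanges [R(q)] and [N(q)]. *)
Lemma tangent_compress q X : Qrho q -> tangent q X -> q *m X *m q = 0.
Proof.
move=> [qq _ _ _] [_ Xq].
have : q *m (X *m q + q *m X) = q *m X by rewrite Xq.
rewrite mulmxDr !mulmxA qq => /eqP.
by rewrite -[X in _ == X]add0r (inj_eq (addIr _)) => /eqP.
Qed.

(** Conjugation by the Cayley transform of [t W], where [W = [X, q] / 2] is
    skew for [sharp], stays in [Qrho].  The velocity at [0] is [2 [W, q]], and
    this is [X] because [q X q = 0] and [X q + q X = X]. *)
Lemma curve_exists q X : Qrho q -> tangent q X ->
  exists g : R -> 'M[A]_2, [/\ \forall t \near (0 : R), Qrho (g t), g 0 = q &
    is_derive (0 : R^o) (1 : R^o) (g : R^o -> rmatrix A 2 2) X].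
Proof.
move=> Qq tX; have [qq q' _ _] := Qq; have [X' Xq] := tX.
have qXq := tangent_compress Qq tX.
pose W := complex_scale (1 / 2 : R)%:C (X *m q - q *m X).
have skewW : sharp W = - W.
  rewrite sharp_complex_scale sharpD sharpN !sharpM q' /sharp X' -opprB.
  by rewrite complex_scaleN /= oppr0.
pose S (t : R) : 'M[A]_2 := complex_scale t%:C W.
have skewS t : sharp (S t) = - S t.
  by rewrite sharp_complex_scale skewW complex_scaleN /= oppr0.
pose L (t : R) := xget 0 [set L | L *m (1%:M - S t) = 1%:M /\ (1%:M - S t) *m L = 1%:M].
pose small (t : R) := `|t| * nrm W <= 1 / 2.
have Wq : (W *m q - q *m W) *+ 2 = X.
  have -> : W *m q - q *m W = complex_scale (1 / 2 : R)%:C X.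
    rewrite complex_scale_mulmxl complex_scale_mulmxr -complex_scaleN -complex_scaleDr.
    congr complex_scale; rewrite mulmxBl mulmxBr !mulmxA -!(mulmxA _ q q) qq qXq.
    by rewrite subr0 sub0r opprK.
  rewrite mulr2n -complex_scaleDl -rmorphD /= -[1 / 2 + 1 / 2]splitr.
  by rewrite complex_scale1.
have Sq t : (S t *m q - q *m S t) *+ 2 = complex_scale t%:C X.
  rewrite complex_scale_mulmxl complex_scale_mulmxr -complex_scaleN -complex_scaleDr.
  by rewrite -[in RHS]Wq !mulr2n [RHS]complex_scaleDr.
have LP t : small t -> L t *m (1%:M - S t) = 1%:M /\ (1%:M - S t) *m L t = 1%:M.
  move=> ts; have [|M HM] := @neumann_inverse _ A (S t).
    by rewrite complex_scale_norm.
  by rewrite /L; case: xgetP => [//|/(_ M)].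
pose m t := L t *m (1%:M + S t).
pose g t := m t *m q *m sharp (m t).
have um t : small t -> unitary_theta (m t).
  by move=> /LP[LS SL]; exact: cayley_unitary.
have gE t : small t -> (g t - q) - complex_scale t%:C X =
    S t *m (g t - q) - (g t - q) *m S t + S t *m (g t - q) *m S t.
  move=> ts; rewrite -Sq; apply: cayley_conj_expand.
  have [LS SL] := LP _ ts.
  have : sharp (L t) *m (1%:M + S t) = 1%:M.
    by rewrite -[S t]opprK -skewS -sharp1 -sharpN -sharpD -sharpM SL.
  have : sharp (1%:M + S t) = 1%:M - S t by rewrite sharpD sharp1 skewS.
  rewrite /g /m sharpM => ->; move: (sharp (L t)) => K KS.
  rewrite !mulmxA SL mul1mx -(mulmxA _ K) KS mulmx1.
  by [].
have nSd t (d : 'M[A]_2) : small t ->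
    nrm (S t *m d - d *m S t + S t *m d *m S t) <= 3 * (`|t| * nrm W) * nrm d.
  move=> ts; have nS : nrm (S t) = `|t| * nrm W by rewrite complex_scale_norm.
  have h1 := norm_mulmx (S t) d; have h2 := norm_mulmx d (S t).
  have h3 : nrm (S t *m d *m S t) <= nrm (S t) * nrm d.
    rewrite (le_trans (norm_mulmx _ _)) // (le_trans _ h1) // ler_piMr // nS.
    by apply: le_trans ts _; lra.
  have := ler_normD (S t *m d - d *m S t : rmatrix A 2 2) (S t *m d *m S t).
  have := ler_normB (S t *m d : rmatrix A 2 2) (d *m S t).
  rewrite -nS; lra.
pose B := 2 * nrm 1%:M * (nrm 1%:M + 1 / 2).
have nm t : small t -> nrm (m t) <= B.
  move=> ts; have [_ SL] := LP _ ts.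
  have nS : nrm (S t) <= 1 / 2 by rewrite complex_scale_norm.
  rewrite (le_trans (norm_mulmx _ _)) // ler_pM //; first exact: norm_inverse SL.
  by rewrite (le_trans (ler_normD _ _)) // lerD2l.
pose K0 := B * nrm q * (nrm (rho A) ^+ 2 * B) + nrm q.
have nd t : small t -> nrm (g t - q) <= K0.
  move=> ts; rewrite (le_trans (ler_normB _ _)) // lerD2r.
  rewrite (le_trans (norm_mulmx _ _)) // ler_pM //.
    by rewrite (le_trans (norm_mulmx _ _)) // ler_wpM2r // nm.
  by rewrite (le_trans (norm_sharp _)) // ler_wpM2l ?exprn_ge0 // nm.
have g0 : g 0 = q.
  have s0 : small 0 by rewrite /small normr0 mul0r; lra.
  have S0 : S 0 = 0 by rewrite /S /complex_scale /= !scale0r.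
  have := gE _ s0; rewrite /complex_scale !scale0r subr0 S0 !mul0mx mulmx0.
  by rewrite subrr addr0 => /subr0_eq.
have near_small : \forall t \near (0 : R), small t.
  have w1 : 0 < nrm W + 1 by rewrite ltr_wpDl.
  have : \forall t \near (0 : R^o), `|t| <= 1 / 2 / (nrm W + 1).
    by apply: (@nbhs0_le _ R^o); rewrite !divr_gt0.
  apply: filterS => t; rewrite ler_pdivlMr // /small => h.
  by apply: le_trans h; rewrite ler_wpM2l // lerDl.
exists g; split=> //.
  by apply: filterS near_small => t /um ut; exact: unitary_conj_Qrho.
pose K1 := 3 * nrm W * K0 + nrm X.
apply: (@is_derive_quadratic _ _ _ (3 * nrm W * K1)).
apply: filterS near_small => t ts; rewrite g0.
have h1 := nSd t (g t - q) ts; rewrite -gE // in h1.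
rewrite (le_trans h1) //.
(* A first use of the remainder bound, with [g t] bounded, gives [g t - q = O(t)]. *)
have h2 : nrm (g t - q) <= `|t| * K1.
  rewrite -[g t - q](subrK (complex_scale t%:C X)) (le_trans (ler_normD _ _)) //.
  rewrite complex_scale_norm mulrDr lerD // (le_trans h1) //.
  rewrite (_ : `|t| * (3 * nrm W * K0) = 3 * (`|t| * nrm W) * K0); last by ring.
  by rewrite ler_wpM2l ?mulr_ge0 // nd.
rewrite (le_trans (ler_wpM2l _ h2)) ?mulr_ge0 //.
rewrite -[t ^+ 2]real_normK ?num_real // le_eqVlt; apply/orP; left; apply/eqP; ring.
Qed.

End Curves.

(** * Directional derivatives of smooth maps on the manifold *)

Section DirectionalDerivative.
Context {R : realType} {A : cstarAlgType R}.
Implicit Types (q X Y : 'M[A]_2) (F G : normedModType R).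

Lemma is_derive_comp1 (E F : normedModType R) (c : R^o -> E) (g : E -> F) (v : E) :
  is_derive (0 : R^o) (1 : R^o) c v -> differentiable g (c 0) ->
  is_derive (0 : R^o) (1 : R^o) (g \o c) ('d g (c 0) v).
Proof.
move=> [dc cv] dg.
have dfc : differentiable c (0 : R^o) by apply/derivable1_diffP.
split; first by apply: diff_derivable; exact: differentiable_comp.
rewrite deriveE; last exact: differentiable_comp.
have dcv : 'd c (0 : R^o) 1 = v by rewrite -deriveE.
by rewrite diff_comp //= dcv.
Qed.

(** The chain rule along curves shows that the right-hand side has the defining
    property; it is the only such value since some curve has velocity [X]. *)
Lemma dirder_ext F (f : 'M[A]_2 -> F) (g : rmatrix A 2 2 -> F) q X :
  Qrho q -> tangent q X ->
  (\forall p \near (q : rmatrix A 2 2), Qrho p -> f p = g p) ->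
  differentiable g (q : rmatrix A 2 2) -> dirder f q X = 'd g (q : rmatrix A 2 2) X.
Proof.
move=> Qq tX fg dg.
have fc (c : R -> 'M[A]_2) : (\forall t \near (0 : R), Qrho (c t)) -> c 0 = q ->
    is_derive (0 : R^o) (1 : R^o) (c : R^o -> rmatrix A 2 2) X ->
    is_derive (0 : R^o) (1 : R^o) (f \o c : R^o -> F) ('d g (q : rmatrix A 2 2) X).
  move=> Qc c0 dc.
  have dgc : is_derive (0 : R^o) (1 : R^o) (g \o (c : R^o -> rmatrix A 2 2))
      ('d g (q : rmatrix A 2 2) X).
    by move: dg; rewrite -c0 => dg; exact: is_derive_comp1.
  have cc : {for (0 : R^o), continuous (c : R^o -> rmatrix A 2 2)}.
    by apply: differentiable_continuous; apply/derivable1_diffP; have [] := dc.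
  have fgc : \forall t \near (0 : R^o), Qrho (c t) -> f (c t) = g (c t).
    by apply: (cc (fun p => Qrho p -> f p = g p)); rewrite c0.
  apply: near_eq_is_derive dgc.
  by move: Qc fgc; apply: filterS2 => t Qt /(_ Qt).
apply: xget_unique; first exact: fc.
move=> d dP; have [c [Qc c0 dc]] := curve_exists Qq tX.
by have [_ <-] := dP _ Qc c0 dc; have [_ <-] := fc _ Qc c0 dc.
Qed.

End DirectionalDerivative.

Section SmoothMaps.
Context {R : realType} {A : cstarAlgType R}.
Implicit Types (q X Y : 'M[A]_2) (F G H : normedModType R).

Lemma smooth_differentiable (E F : normedModType R) (U : set E) (f : E -> F) x :
  smooth U f -> U x -> differentiable f x.
Proof. by move=> /(_ 1%N)[df _]; exact: df. Qed.

Lemma smooth_diff (E F : normedModType R) (U : set E) (f : E -> F) :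
  smooth U f -> smooth (U `*` [set: E]) (fun p : E * E => 'd f (p.1) (p.2)).
Proof. by move=> Cf n; have [] := Cf n.+1. Qed.

Lemma smoothQ_germ F (f : 'M[A]_2 -> F) q : smoothQ f -> Qrho q ->
  exists g : rmatrix A 2 2 -> F,
   [/\ differentiable g (q : rmatrix A 2 2), f q = g q &
       \forall p \near (q : rmatrix A 2 2), Qrho p -> f p = g p].
Proof.
move=> sf Qq; have [U [g [oU Uq sg fg]]] := sf _ Qq; exists g; split.
- exact: smooth_differentiable sg Uq.
- exact: fg.
- by apply: filterS (open_nbhs_nbhs (conj oU Uq)) => p Up; exact: fg.
Qed.

Lemma smoothQ_pair F G (f : 'M[A]_2 -> F) (g : 'M[A]_2 -> G) :
  smoothQ f -> smoothQ g -> @smoothQ R A (F * G)%type (fun p => (f p, g p)).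
Proof.
move=> sf sg q Qq.
have [U [f' [oU Uq sf' ff']]] := sf _ Qq; have [V [g' [oV Vq sg' gg']]] := sg _ Qq.
have oUV : open (U `&` V) by exact: openI.
exists (U `&` V), (fun p => (f' p, g' p)); split=> //.
  move=> n; apply: class_C_pair => //.
    by apply: class_C_sub (sf' n) => p [].
  by apply: class_C_sub (sg' n) => p [].
by move=> p [Up Vp] Qp; rewrite -ff' // -gg'.
Qed.

Lemma smoothQ_comp F G (f : 'M[A]_2 -> F) (h : F -> G) :
  smoothQ f -> smooth [set: F] h -> smoothQ (h \o f).
Proof.
move=> sf sh q Qq; have [U [f' [oU Uq sf' ff']]] := sf _ Qq.
exists U, (h \o f'); split=> //.
  by move=> n; apply: class_C_comp (sf' n) (sh n).
by move=> p Up Qp; rewrite /= -ff'.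
Qed.

Lemma smoothQ_cst F (a : F) : @smoothQ R A F (fun _ => a).
Proof.
move=> q Qq; exists [set: _], (cst a); split=> //; first exact: openT.
by move=> n; apply: class_C_cst; exact: openT.
Qed.

Lemma smoothQ_id : @smoothQ R A (rmatrix A 2 2) (fun p => p).
Proof.
move=> q Qq; exists [set: _], (fun p => p); split=> //; first exact: openT.
move=> n; apply: (@class_C_linear _ _ _ _ _ idfun); first exact: openT.
by move=> p; exact: cvg_id.
Qed.

Lemma smoothQ_dirder F (f : 'M[A]_2 -> F) (X : 'M[A]_2 -> 'M[A]_2) :
  smoothQ f -> vector_field X -> smoothQ (fun q => dirder f q (X q)).
Proof.
move=> sf [tX sX] q Qq.
have [U [f' [oU Uq sf' ff']]] := sf _ Qq; have [V [X' [oV Vq sX' XX']]] := sX _ Qq.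
have oUV : open (U `&` V) by exact: openI.
exists (U `&` V), (fun p => 'd f' (p : rmatrix A 2 2) (X' p)); split=> //.
  move=> n; apply: (class_C_comp oUV (f := fun p => (p, X' p)) _ _ (smooth_diff sf' n)).
    by move=> p [].
  apply: class_C_pair => //.
    apply: (@class_C_linear _ _ _ _ _ idfun) => //.
    by move=> p; exact: cvg_id.
  by apply: class_C_sub (sX' n) => p [].
move=> p [Up Vp] Qp; rewrite (@dirder_ext _ _ _ f f') ?XX' //.
- by rewrite -XX' //; exact: tX.
- by apply: filterS (open_nbhs_nbhs (conj oU Up)) => r Ur; exact: ff'.
- exact: smooth_differentiable sf' Up.
Qed.

Lemma dirder_near F (f g : 'M[A]_2 -> F) q X : smoothQ f ->
  Qrho q -> tangent q X ->
  (\forall p \near (q : rmatrix A 2 2), Qrho p -> f p = g p) ->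
  dirder f q X = dirder g q X.
Proof.
move=> sf Qq tX fg; have [f' [df' _ ff']] := smoothQ_germ sf Qq.
rewrite (dirder_ext Qq tX ff' df') (dirder_ext Qq tX _ df') //.
by apply: filterS2 fg ff' => p + + Qp => <- // ->.
Qed.

Lemma dirder_pair F G (f : 'M[A]_2 -> F) (g : 'M[A]_2 -> G) q X :
  smoothQ f -> smoothQ g -> Qrho q -> tangent q X ->
  @dirder R A (F * G)%type (fun p => (f p, g p)) q X = (dirder f q X, dirder g q X).
Proof.
move=> sf sg Qq tX.
have [f' [df' _ ff']] := smoothQ_germ sf Qq; have [g' [dg' _ gg']] := smoothQ_germ sg Qq.
rewrite (dirder_ext Qq tX ff' df') (dirder_ext Qq tX gg' dg').
rewrite (@dirder_ext _ _ (F * G)%type _ (fun p => (f' p, g' p)) _ _ Qq tX).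
- by rewrite diff_pair.
- by apply: filterS2 ff' gg' => p fp gp Qp; rewrite fp // gp.
- exact: differentiable_pair.
Qed.

Lemma dirder_comp F G (f : 'M[A]_2 -> F) (h : F -> G) q X :
  smoothQ f -> differentiable h (f q) -> Qrho q -> tangent q X ->
  dirder (h \o f) q X = 'd h (f q) (dirder f q X).
Proof.
move=> sf dh Qq tX; have [f' [df' fq ff']] := smoothQ_germ sf Qq.
rewrite (dirder_ext Qq tX ff' df').
rewrite (@dirder_ext _ _ _ (h \o f) (h \o f') _ _ Qq tX).
- by rewrite diff_comp //= -?fq.
- by apply: filterS ff' => p fp Qp; rewrite /= fp.
- by apply: differentiable_comp => //; rewrite -fq.
Qed.

Lemma dirder_diff F (f : rmatrix A 2 2 -> F) q X : Qrho q -> tangent q X ->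
  differentiable f (q : rmatrix A 2 2) ->
  dirder f q X = 'd f (q : rmatrix A 2 2) X.
Proof.
move=> Qq tX df; apply: dirder_ext => //.
by apply: (@filterE _ (nbhs (q : rmatrix A 2 2))) => p.
Qed.

Lemma dirder_cst F (a : F) q X : Qrho q -> tangent q X ->
  dirder (fun _ : 'M[A]_2 => a) q X = 0.
Proof.
by move=> Qq tX; rewrite (@dirder_diff _ (cst a)) ?diff_cst.
Qed.

Lemma dirder_id q X : Qrho q -> tangent q X ->
  @dirder R A (rmatrix A 2 2) (fun p => p) q X = X.
Proof.
move=> Qq tX; rewrite (@dirder_diff _ idfun) //.
by rewrite diff_lin // => p; exact: cvg_id.
Qed.

Lemma tangent_linear q (r : R) X Y : tangent q X -> tangent q Y ->
  tangent q (complex_scale r%:C X + Y).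
Proof.
move=> [X' Xq] [Y' Yq]; split.
  rewrite -/(sharp _) sharpD sharp_complex_scale /= oppr0 /sharp X' Y' //.
rewrite mulmxDl mulmxDr addrACA Yq complex_scale_mulmxl complex_scale_mulmxr.
by rewrite -complex_scaleDr Xq.
Qed.

Lemma dirder_linearX F (f : 'M[A]_2 -> F) q X Y (r : R) : smoothQ f -> Qrho q ->
  tangent q X -> tangent q Y ->
  dirder f q (complex_scale r%:C X + Y) = r *: dirder f q X + dirder f q Y.
Proof.
move=> sf Qq tX tY; have [f' [df' _ ff']] := smoothQ_germ sf Qq.
rewrite !(dirder_ext Qq _ ff' df') //; last exact: tangent_linear.
exact: (linearP ('d f' (q : rmatrix A 2 2)) r X Y).
Qed.

End SmoothMaps.

(** * Iterated derivatives and the Lie bracket *)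

Section SecondOrder.
Context {R : realType} {A : cstarAlgType R}.

(** [p |-> dg p.1 p.2] is linear in its second variable, so its partial
    differential there is itself. *)
Lemma diff_linear_partial (E F : normedModType R) (g : E -> F) (x v w : E) :
  differentiable g x ->
  differentiable (fun p : E * E => 'd g (p.1) (p.2)) (x, v) ->
  'd (fun p : E * E => 'd g (p.1) (p.2)) (x, v) (0, w) = 'd g x w.
Proof.
set g2 := (fun p : E * E => 'd g (p.1) (p.2)) => dg d2g.
have dp : is_diff v (fun y : E => (x, y)) (fun y => (0, y)).
  by have := is_diff_pair (is_diff_cst x v) (is_diff_id v).
have h : 'd (g2 \o (fun y : E => (x, y))) v w = 'd g2 (x, v) (0, w).
  by rewrite diff_comp //= diff_val.
rewrite -h; have -> : g2 \o (fun y : E => (x, y)) = 'd g x by [].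
by rewrite diff_lin //; exact: diff_continuous.
Qed.

(** [d1] and [d2] are the first and second differentials at [q] of a local
    extension of [f].  The vector [Y . Z] need not be tangent, which is why the
    last formula uses [d1] and not a directional derivative of [f]. *)
Lemma dirder_dirder (F : normedModType R) (f : 'M[A]_2 -> F) q :
  smoothQ f -> Qrho q ->
  exists (d1 : {linear rmatrix A 2 2 -> F}) (d2 : 'M[A]_2 -> 'M[A]_2 -> F),
  [/\ forall X, tangent q X -> dirder f q X = d1 X,
      forall X Y, d2 X Y = d2 Y X &
      forall (Y : 'M[A]_2 -> 'M[A]_2) Z, vector_field Y -> tangent q Z ->
        dirder (fun p => dirder f p (Y p)) q Z =
          d2 Z (Y q) + d1 (@dirder _ _ (rmatrix A 2 2) Y q Z)].
Proof.
move=> sf Qq; have [U [g [oU Uq sg fg]]] := sf _ Qq.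
pose g2 (p : rmatrix A 2 2 * rmatrix A 2 2) := 'd g (p.1) (p.2).
have dg (p : rmatrix A 2 2) : U p -> differentiable g p := smooth_differentiable sg.
have dg2 (p v : rmatrix A 2 2) : U p -> differentiable g2 (p, v).
  by move=> Up; apply: smooth_differentiable (smooth_diff sg) _.
have dE p X : U p -> Qrho p -> tangent p X -> dirder f p X = g2 (p, X).
  move=> Up Qp tX; apply: (dirder_ext Qp tX _ (dg _ Up)).
  by apply: filterS (open_nbhs_nbhs (conj oU Up)) => r Ur; exact: fg.
pose d2 (X Y : 'M[A]_2) := 'd g2 ((q : rmatrix A 2 2), (Y : rmatrix A 2 2))
  ((X : rmatrix A 2 2), (0 : rmatrix A 2 2)).
exists ('d g (q : rmatrix A 2 2)), d2; split=> [X tX||].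
  exact: dE.
  move=> X Y; apply: second_differential_sym; last by move=> w; exact: dg2.
  by apply: filterS (open_nbhs_nbhs (conj oU Uq)) => p; exact: dg.
move=> Y Z [tY sY] tZ; have [V [Y' [oV Vq sY' YY']]] := sY _ Qq.
have dY' := smooth_differentiable sY' Vq.
have YZ : @dirder _ _ (rmatrix A 2 2) Y q Z = 'd Y' (q : rmatrix A 2 2) Z.
  apply: (dirder_ext Qq tZ _ dY').
  by apply: filterS (open_nbhs_nbhs (conj oV Vq)) => r Vr; exact: YY'.
rewrite YZ.
have dpair : is_diff (q : rmatrix A 2 2) (fun p => (p, Y' p))
    (fun v => (v, 'd Y' (q : rmatrix A 2 2) v)).
  by have := is_diff_pair (is_diff_id (q : rmatrix A 2 2)) (differentiableP dY').
rewrite (@dirder_ext _ _ _ _ (g2 \o (fun p => (p, Y' p))) _ _ Qq tZ).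
- rewrite diff_comp //=; last exact: dg2.
  rewrite diff_val /d2 YY' //.
  set w := 'd Y' _ Z.
  have -> : (Z, w) = (Z, 0) + (0, w) :> rmatrix A 2 2 * rmatrix A 2 2.
    by congr pair; rewrite ?addr0 ?add0r.
  by rewrite linearD diff_linear_partial //; [exact: dg|exact: dg2].
- apply: filterS (open_nbhs_nbhs (conj (openI oU oV) (conj Uq Vq))) => p [Up Vp] Qp.
  by rewrite dE ?YY' //= -YY' //; exact: tY.
- by apply: differentiable_comp => //; exact: dg2.
Qed.

(** The second differentials cancel by symmetry. *)
Lemma dirder_lie_bracket (F : normedModType R) (f : 'M[A]_2 -> F)
    (X Y : 'M[A]_2 -> 'M[A]_2) q :
  smoothQ f -> vector_field X -> vector_field Y -> Qrho q ->
  tangent q (lie_bracket X Y q) ->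
  dirder (fun p => dirder f p (Y p)) q (X q) -
  dirder (fun p => dirder f p (X p)) q (Y q) = dirder f q (lie_bracket X Y q).
Proof.
move=> sf vX vY Qq tXY; have [d1 [d2 [d1E d2C d2E]]] := dirder_dirder sf Qq.
rewrite !d2E //; [|exact: (proj1 vY)|exact: (proj1 vX)].
by rewrite d1E // linearB opprD addrACA d2C subrr add0r.
Qed.


End SecondOrder.

(** * Leibniz rules for matrix valued maps *)

Section MatrixCalculus.
Context {R : realType} {A : cstarAlgType R}.

(** The matrix product seen between the real normed spaces [rmatrix], where it is
    bilinear over [R] for the scalings of these spaces. *)
Definition rmulmx m n p (M : rmatrix A m n) (N : rmatrix A n p) : rmatrix A m p :=
  (M : 'M[A]_(m, n)) *m (N : 'M[A]_(n, p)).

Lemma rmulmx_is_bilinear m n p :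
  bilinear_for
    (GRing.Scale.Law.clone _ _ *:%R _) (GRing.Scale.Law.clone _ _ *:%R _)
    (@rmulmx m n p).
Proof.
split=> [N|M] r x y.
- by rewrite [LHS]mulmxDl; congr (_ + _); exact: complex_scale_mulmxl.
- by rewrite [LHS]mulmxDr; congr (_ + _); exact: complex_scale_mulmxr.
Qed.
HB.instance Definition _ m n p := bilinear_isBilinear.Build R
  (rmatrix A m n) (rmatrix A n p) (rmatrix A m p) _ _ (@rmulmx m n p)
  (rmulmx_is_bilinear m n p).

Lemma continuous_bounded_bilinear (E F G : normedModType R)
    (b : {bilinear E -> F -> G}) :
  (forall x y, `|b x y| <= `|x| * `|y|) -> continuous (fun p => b p.1 p.2).
Proof.
move=> bb z; apply/cvgrPdist_le => e e0; set x := z.1; set y := z.2.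
pose C := `|x| + `|y| + 1.
have C0 : 0 < C by rewrite ltr_wpDl // addr_ge0.
pose d := Num.min 1 (e / C).
have d0 : 0 < d by rewrite lt_min ltr01 divr_gt0.
suff : nbhs z (fun p => `|b x y - b p.1 p.2| <= e) by [].
apply/nbhs_ballP; exists d => // -[x' y'] [] /=; rewrite -/x -/y.
rewrite -!ball_normE /= => /ltW hx /ltW hy.
have -> : b x y - b x' y' = b (x - x') y + b x' (y - y').
  by rewrite linearBl linearBr addrA subrK.
have x'1 : `|x'| <= `|x| + 1.
  rewrite -[x'](subrK x) addrC (le_trans (ler_normD _ _)) // lerD2l distrC.
  by rewrite (le_trans hx) // ge_min lexx.
have dC : d * C <= e by rewrite -ler_pdivlMr // ge_min lexx orbT.
rewrite (le_trans (ler_normD _ _)) // (le_trans _ dC) //.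
rewrite (le_trans (lerD (bb _ _) (bb _ _))) //.
rewrite (_ : d * C = d * `|y| + (`|x| + 1) * d); last by rewrite /C; ring.
by rewrite lerD // ler_pM.
Qed.

Lemma continuous_bounded_linear (E F : normedModType R) (f : {linear E -> F}) (C : R) :
  (forall x, `|f x| <= C * `|x|) -> continuous f.
Proof.
move=> fC x; apply/cvgrPdist_le => e e0 /=.
have C1 : 0 < `|C| + 1 by rewrite ltr_wpDl.
apply/nbhs_ballP; exists (e / (`|C| + 1)); first by rewrite /= divr_gt0.
move=> y; rewrite -ball_normE /= => /ltW xy.
rewrite -linearB (le_trans (fC _)) //.
rewrite (@le_trans _ _ ((`|C| + 1) * `|x - y|)) //; last by rewrite mulrC -ler_pdivlMr.
by rewrite ler_wpM2r // (le_trans (ler_norm _)) // lerDl.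
Qed.

Lemma continuous_rmulmx m n p :
  continuous (fun q : rmatrix A m n * rmatrix A n p => rmulmx q.1 q.2).
Proof. by apply: continuous_bounded_bilinear => M N; exact: norm_mulmx. Qed.

Implicit Types (q X Y : 'M[A]_2).

Lemma smoothQ_mulmx m n p (f : 'M[A]_2 -> 'M[A]_(m, n)) (g : 'M[A]_2 -> 'M[A]_(n, p)) :
  @smoothQ R A (rmatrix A m n) f -> @smoothQ R A (rmatrix A n p) g ->
  @smoothQ R A (rmatrix A m p) (fun x => f x *m g x).
Proof.
move=> sf sg.
pose h (r : rmatrix A m n * rmatrix A n p) := rmulmx r.1 r.2.
suff sh : smooth [set: rmatrix A m n * rmatrix A n p] h.
  exact: (smoothQ_comp (smoothQ_pair sf sg) sh).
move=> k.
by apply: class_C_bilinear; [exact: openT|exact: continuous_rmulmx].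
Qed.

Lemma dirder_mulmx m n p (f : 'M[A]_2 -> 'M[A]_(m, n)) (g : 'M[A]_2 -> 'M[A]_(n, p))
    q X :
  @smoothQ R A (rmatrix A m n) f -> @smoothQ R A (rmatrix A n p) g ->
  Qrho q -> tangent q X ->
  @dirder R A (rmatrix A m p) (fun x => f x *m g x) q X =
    f q *m (@dirder R A (rmatrix A n p) g q X : 'M[A]_(n, p)) +
    (@dirder R A (rmatrix A m n) f q X : 'M[A]_(m, n)) *m g q.
Proof.
move=> sf sg Qq tX; have sp := smoothQ_pair sf sg.
have db := differentiable_bilin (f q : rmatrix A m n, g q : rmatrix A n p)
  (@continuous_rmulmx m n p).
have := dirder_comp sp db Qq tX; rewrite dirder_pair // => e; rewrite [LHS]e.
by rewrite diff_bilin //; exact: continuous_rmulmx.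
Qed.

Lemma smoothQ_add (F : normedModType R) (f g : 'M[A]_2 -> F) :
  smoothQ f -> smoothQ g -> smoothQ (fun x => f x + g x).
Proof.
move=> sf sg q Qq.
have [U [f' [oU Uq sf' ff']]] := sf _ Qq; have [V [g' [oV Vq sg' gg']]] := sg _ Qq.
have oUV : open (U `&` V) by exact: openI.
exists (U `&` V), (fun p => f' p + g' p); split=> //.
  move=> n; apply: class_C_add => //.
    by apply: class_C_sub (sf' n) => p [].
  by apply: class_C_sub (sg' n) => p [].
by move=> p [Up Vp] Qp; rewrite -ff' // -gg'.
Qed.

Lemma dirder_add (F : normedModType R) (f g : 'M[A]_2 -> F) q X :
  smoothQ f -> smoothQ g -> Qrho q -> tangent q X ->
  dirder (fun x => f x + g x) q X = dirder f q X + dirder g q X.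
Proof.
move=> sf sg Qq tX.
have [f' [df' _ ff']] := smoothQ_germ sf Qq; have [g' [dg' _ gg']] := smoothQ_germ sg Qq.
rewrite (dirder_ext Qq tX ff' df') (dirder_ext Qq tX gg' dg').
have dfg := differentiableD df' dg'.
rewrite (dirder_ext (g := f' + g') Qq tX _ dfg).
  have := congr1 (fun h => h X) (diffD df' dg').
  by move=> e; rewrite [LHS]e.
by apply: filterS2 ff' gg' => p fp gp Qp; rewrite fp // gp.
Qed.

Lemma smoothQ_linear (F G : normedModType R) (h : {linear F -> G}) (f : 'M[A]_2 -> F) :
  smoothQ f -> continuous h -> smoothQ (fun x => h (f x)).
Proof.
move=> sf ch; apply: (smoothQ_comp sf (h := h)) => n.
by apply: class_C_linear => //; exact: openT.
Qed.

Lemma dirder_linear (F G : normedModType R) (h : {linear F -> G})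
    (f : 'M[A]_2 -> F) q X :
  smoothQ f -> continuous h -> Qrho q -> tangent q X ->
  dirder (fun x => h (f x)) q X = h (dirder f q X).
Proof.
move=> sf ch Qq tX; have dh : differentiable h (f q) by exact: linear_differentiable.
by rewrite (dirder_comp (h := h) sf dh) // diff_lin.
Qed.

Definition rsharp (M : rmatrix A 2 2) : rmatrix A 2 2 := sharp (M : 'M[A]_2).

Lemma rsharp_linear : linear rsharp.
Proof.
move=> r M N; rewrite /rsharp sharpD; congr (_ + _).
by rewrite [LHS](sharp_complex_scale r%:C (M : 'M[A]_2)) /= oppr0.
Qed.
HB.instance Definition _ := GRing.isLinear.Build R (rmatrix A 2 2) (rmatrix A 2 2)
  _ rsharp rsharp_linear.

Lemma continuous_rsharp : continuous rsharp.
Proof.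
exact: (@continuous_bounded_linear _ _ rsharp _ (fun M => @norm_sharp R A M)).
Qed.

Lemma smoothQ_complex_scale m n (z : R[i]) (f : 'M[A]_2 -> 'M[A]_(m, n)) :
  @smoothQ R A (rmatrix A m n) f ->
  @smoothQ R A (rmatrix A m n) (fun p => complex_scale z (f p)).
Proof.
move=> sf; have := smoothQ_mulmx (smoothQ_cst ((z%:A)%:M : rmatrix A m m)) sf.
by congr smoothQ; apply/funext => p; rewrite mul_scalar_mx.
Qed.

Lemma dirder_complex_scale m n (z : R[i]) (f : 'M[A]_2 -> 'M[A]_(m, n)) q X :
  @smoothQ R A (rmatrix A m n) f -> Qrho q -> tangent q X ->
  @dirder R A (rmatrix A m n) (fun p => complex_scale z (f p)) q X =
    complex_scale z (@dirder R A (rmatrix A m n) f q X : 'M[A]_(m, n)).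
Proof.
move=> sf Qq tX; have sz := smoothQ_cst (R := R) (A := A) ((z%:A)%:M : rmatrix A m m).
have := dirder_mulmx sz sf Qq tX; rewrite dirder_cst // mul0mx addr0.
move=> e; rewrite -[RHS]mul_scalar_mx -[RHS]e.
by congr dirder; apply/funext => p; rewrite mul_scalar_mx.
Qed.

(** The scalar function is turned into the matrix function [f p *: 1], so that this is
    the rule for matrix products. *)
Lemma dirder_realscale m n (f : 'M[A]_2 -> R^o) (g : 'M[A]_2 -> 'M[A]_(m, n)) q X :
  smoothQ f -> @smoothQ R A (rmatrix A m n) g -> Qrho q -> tangent q X ->
  @dirder R A (rmatrix A m n) (fun p => complex_scale (f p)%:C (g p)) q X =
    complex_scale (dirder f q X)%:C (g q) +
    complex_scale (f q)%:C (@dirder R A (rmatrix A m n) g q X : 'M[A]_(m, n)).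
Proof.
move=> sf sg Qq tX.
pose h (r : R^o) : rmatrix A m m := r *: (1%:M : rmatrix A m m).
have hL : linear h by move=> r x y; rewrite /h scalerDl -scalerA.
pose hM := GRing.isLinear.Build _ _ _ _ _ hL.
pose hl : {linear R^o -> rmatrix A m m} := HB.pack h hM.
have hc : continuous hl.
  apply: (@continuous_bounded_linear _ _ hl `|1%:M : rmatrix A m m|) => r.
  by rewrite /= /h normrZ mulrC.
have hE (r : R) (M : 'M[A]_(m, n)) : (h r : 'M[A]_m) *m M = complex_scale r%:C M.
  by rewrite [LHS]complex_scale_mulmxl mul1mx.
have := dirder_mulmx (smoothQ_linear (h := hl) sf hc) sg Qq tX.
rewrite (dirder_linear (h := hl) sf hc Qq tX) /= !hE addrC => <-.
by congr dirder; apply/funext => p; rewrite hE.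
Qed.

(** Differentiating [V = V p + p V] along [U] gives an identity whose extra term
    [V U + U V] is symmetric in the two fields. *)
Lemma lie_bracket_tangent (X Y : 'M[A]_2 -> 'M[A]_2) q :
  vector_field X -> vector_field Y -> Qrho q -> tangent q (lie_bracket X Y q).
Proof.
move=> vX vY Qq.
have half (U V : 'M[A]_2 -> 'M[A]_2) : vector_field U -> vector_field V ->
    let W := @dirder R A (rmatrix A 2 2) V q (U q) : 'M[A]_2 in
    sharp W = W /\ W *m q + q *m W + (V q *m U q + U q *m V q) = W.
  move=> [tU sU] [tV sV] W; have tUq := tU _ Qq; split.
    have := dirder_linear (h := rsharp) sV continuous_rsharp Qq tUq.
    move=> /esym e; rewrite [LHS]e.
    apply: (@dirder_near _ _ (rmatrix A 2 2) (fun x => rsharp (V x)) V) => //.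
      by apply: (smoothQ_linear (h := rsharp)) => //; exact: continuous_rsharp.
    by apply: (@filterE _ (nbhs (q : rmatrix A 2 2))) => p /tV[].
  have sid := @smoothQ_id R A.
  have sl := @smoothQ_mulmx 2 2 2 _ _ sV sid; have sr := @smoothQ_mulmx 2 2 2 _ _ sid sV.
  have e : W = @dirder R A (rmatrix A 2 2) (fun p => V p *m p + p *m V p) q (U q).
    apply: (@dirder_near _ _ (rmatrix A 2 2) V) => //.
    by apply: (@filterE _ (nbhs (q : rmatrix A 2 2))) => p /tV[].
  have := @dirder_add (rmatrix A 2 2) _ _ q (U q) sl sr Qq tUq.
  rewrite !dirder_mulmx // dirder_id // -/W -[LHS]/(dirder _ _ _) => e'.
  rewrite [RHS]e [RHS]e'.
  by rewrite [in RHS](addrC (V q *m U q)) [RHS]addrACA.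
have [sX eX] := half _ _ vY vX; have [sY eY] := half _ _ vX vY.
rewrite /lie_bracket; split.
  by rewrite -/(sharp _) sharpD sharpN sX sY.
rewrite mulmxBl mulmxBr addrACA -opprD -[in RHS]eX -[in RHS]eY.
by rewrite (addrC (X q *m Y q)) [in RHS]opprD [RHS]addrACA subrr addr0.
Qed.

End MatrixCalculus.

(** * The connection of the tautological bundle *)

Section Tautological.
Context {R : realType} {A : cstarAlgType R}.
Implicit Types (q X Y m : 'M[A]_2) (s t : 'M[A]_2 -> tautological A).

Lemma range_ofE q (v : 'cV[A]_2) : Qrho q -> range_of q v <-> q *m v = v.
Proof.
move=> [qq _ _ _]; split=> [[w ->]|<-]; first by rewrite mulmxA qq.
by exists v.
Qed.

Lemma section_range s q : bsection s -> Qrho q -> q *m (s q : 'cV[A]_2) = s q.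
Proof. by move=> [rs _] Qq; apply/range_ofE => //; exact: rs. Qed.

(** This is the derivative along [X] of [s p = p s p]. *)
Lemma section_normal s q X : bsection s -> Qrho q -> tangent q X ->
  q *m (@dirder R A (rmatrix A 2 1) s q X : 'cV[A]_2) + X *m (s q : 'cV[A]_2) =
    @dirder R A (rmatrix A 2 1) s q X.
Proof.
move=> bs Qq tX; have [rs ss] := bs.
rewrite -[X in _ + X *m _](@dirder_id R A q X) //.
rewrite -(@dirder_mulmx R A 2 2 1 (fun p => p) s) //; last exact: smoothQ_id.
symmetry; apply: (@dirder_near _ _ (rmatrix A 2 1) s) => //.
by apply: (@filterE _ (nbhs (q : rmatrix A 2 2))) => p Qp; rewrite section_range.
Qed.

Lemma cst_section (v : 'cV[A]_2) :
  bsection ((fun p => p *m v) : 'M[A]_2 -> tautological A).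
Proof.
split; first by move=> q _; exists v.
exact: smoothQ_mulmx (@smoothQ_id R A) (smoothQ_cst (v : rmatrix A 2 1)).
Qed.

Lemma conn_taut_section (X : 'M[A]_2 -> 'M[A]_2) s : vector_field X -> bsection s ->
  bsection ((fun q => conn_taut q (X q) s) : 'M[A]_2 -> tautological A).
Proof.
move=> vX [_ ss]; split; first by move=> q _; eexists.
exact: smoothQ_mulmx (@smoothQ_id R A) (smoothQ_dirder ss vX).
Qed.

Lemma conn_taut_connection : connection (@conn_taut R A).
Proof.
split.
- by move=> q X s _ _ _; eexists.
- by move=> X s; exact: conn_taut_section.
- move=> q X s t U Qq tX [_ ss] _ oU Uq st; congr (_ *m _).
  apply: (@dirder_near _ _ (rmatrix A 2 1)) => //.
  by apply: filterS (open_nbhs_nbhs (conj oU Uq)) => p; exact: st.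
- move=> q X Y s r Qq tX tY [_ ss]; rewrite /conn_taut /=.
  by rewrite (dirder_linearX r ss Qq tX tY) mulmxDr [in LHS]complex_scale_mulmxr.
- move=> q X s t z Qq tX [_ ss] [_ st]; rewrite /conn_taut /=.
  have sz := smoothQ_complex_scale z ss.
  rewrite (@dirder_add _ _ (rmatrix A 2 1) _ _ q X sz st Qq tX) mulmxDr.
  by rewrite dirder_complex_scale // complex_scale_mulmxr.
- move=> q X s f Qq tX bs sf; rewrite /conn_taut /=.
  rewrite (dirder_realscale sf (proj2 bs) Qq tX) mulmxDr !complex_scale_mulmxr.
  by rewrite section_range.
Qed.

Lemma unitary_sharp m : unitary_theta m -> unitary_theta (sharp m).
Proof. by move=> [mm' m'm]; split; rewrite sharpK. Qed.

Lemma unitary_conj_tangent m q X : unitary_theta m -> tangent q X ->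
  tangent (m *m q *m sharp m) (m *m X *m sharp m).
Proof.
move=> [_ m'm] [X' Xq]; split.
  rewrite -[LHS]/(sharp (m *m X *m sharp m)) (sharpM _ (sharp m)) (sharpM m X) sharpK.
  by rewrite [sharp X]X' mulmxA.
move: m'm; move: (sharp m) => m' m'm.
rewrite !mulmxA -!(mulmxA _ m' m) m'm !mulmx1 -mulmxDl -!mulmxA -mulmxDr.
by rewrite Xq mulmxA.
Qed.

(** The action of [sharp m], the inverse of [m], as a linear map of the ambient
    real normed space. *)
Definition rconj m (p : rmatrix A 2 2) : rmatrix A 2 2 :=
  sharp m *m (p : 'M[A]_2) *m m.

Lemma rconj_linear m : linear (rconj m).
Proof.
move=> r M N; rewrite /rconj mulmxDr mulmxDl; congr (_ + _).
by rewrite [sharp m *m _]complex_scale_mulmxr [LHS]complex_scale_mulmxl.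
Qed.
HB.instance Definition _ m := GRing.isLinear.Build R (rmatrix A 2 2) (rmatrix A 2 2)
  _ (rconj m) (rconj_linear m).

Lemma continuous_rconj m : continuous (rconj m).
Proof.
apply: (@continuous_bounded_linear _ _ _ (rconj m)
  (`|sharp m : rmatrix A 2 2| * `|m : rmatrix A 2 2|)) => M.
rewrite mulrAC (le_trans (norm_mulmx _ _)) // ler_wpM2r //.
exact: norm_mulmx.
Qed.

Lemma rconj_Qrho m p : unitary_theta m -> Qrho p -> Qrho (rconj m p).
Proof.
move=> um Qp; have := unitary_conj_Qrho (unitary_sharp um) Qp.
by rewrite sharpK.
Qed.

Lemma rconjK m p : unitary_theta m -> rconj m (m *m p *m sharp m) = p.
Proof.
move=> [_ m'm]; rewrite /rconj; move: m'm; move: (sharp m) => m' m'm.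
by rewrite !mulmxA m'm mul1mx -mulmxA m'm mulmx1.
Qed.

Lemma smoothQ_conj (F : normedModType R) (f : 'M[A]_2 -> F) m :
  unitary_theta m -> smoothQ f -> smoothQ (fun p => f (sharp m *m p *m m)).
Proof.
move=> um sf q Qq; have [U [g [oU Uq sg fg]]] := sf _ (rconj_Qrho um Qq).
have oV : open (rconj m @^-1` U).
  by apply: open_comp => // p _; exact: continuous_rconj.
exists (rconj m @^-1` U), (g \o rconj m); split=> //.
  move=> n; apply: class_C_comp (sg n) => //.
  by apply: class_C_linear => //; exact: continuous_rconj.
by move=> p Up Qp; apply: fg => //; exact: rconj_Qrho.
Qed.

(** Chain rule: [rconj m] is linear, preserves [Qrho], and sends the base point
    and the direction on the left to [q] and [X]. *)
Lemma dirder_conj (F : normedModType R) (f : 'M[A]_2 -> F) m q X :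
  unitary_theta m -> smoothQ f -> Qrho q -> tangent q X ->
  dirder (fun p => f (sharp m *m p *m m)) (m *m q *m sharp m) (m *m X *m sharp m) =
    dirder f q X.
Proof.
move=> um sf Qq tX; have [g [dg _ fg]] := smoothQ_germ sf Qq.
have Qm := unitary_conj_Qrho um Qq; have tm := unitary_conj_tangent um tX.
rewrite (dirder_ext Qq tX fg dg); pose r : rmatrix A 2 2 := m *m q *m sharp m.
have rE : rconj m r = q by exact: rconjK.
have dk : differentiable (rconj m) r.
  by apply: linear_differentiable; exact: continuous_rconj.
have dgr : differentiable g (rconj m r) by rewrite rE.
rewrite (dirder_ext (g := g \o rconj m) Qm tm _ (differentiable_comp dk dgr)).
  have e1 := congr1 (fun h => h (m *m X *m sharp m)) (diff_comp dk dgr).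
  have e2 : 'd (rconj m) r (m *m X *m sharp m) = X :> rmatrix A 2 2.
    have e := congr1 (fun h => h (m *m X *m sharp m))
      (diff_lin r (@continuous_rconj m)).
    exact: etrans e (rconjK X um).
  apply: (etrans e1).
  rewrite /comp e2.
  by rewrite rE.
have fgr : \forall p \near rconj m r, Qrho p -> f p = g p by rewrite rE.
have := continuous_rconj (m := m) (x := r) fgr.
apply: (@filterS _ (nbhs r) _ _ _ _) => p fgp Qp.
by apply: fgp; exact: rconj_Qrho.
Qed.

Lemma conn_taut_invariant : invariant_connection (@conn_taut R A).
Proof.
move=> m q X s um Qq tX [_ ss]; rewrite /conn_taut /=.
have Qm := unitary_conj_Qrho um Qq; have tm := unitary_conj_tangent um tX.
have sc := smoothQ_conj um ss.
rewrite (@dirder_mulmx R A 2 2 1 (fun _ => m) _ _ _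
  (smoothQ_cst (m : rmatrix A 2 2)) sc) //.
rewrite dirder_cst // mul0mx addr0 (dirder_conj um ss Qq tX).
have [_] := um; move: (sharp m) => m' m'm.
by rewrite !mulmxA -(mulmxA _ m' m) m'm mulmx1.
Qed.

(** [D_X D_Y s = q (X . (Y . s)) + q X (Y . s)] and, as [q X q = 0], the last term
    only sees the component [Y s] of [Y . s] in [N(q)].  The terms with two
    derivatives cancel against [D_[X,Y] s]. *)
Lemma conn_taut_curvature (X Y : 'M[A]_2 -> 'M[A]_2) s q :
  vector_field X -> vector_field Y -> bsection s -> Qrho q ->
  curvature (@conn_taut R A) X Y s q =
    q *m (X q *m Y q - Y q *m X q) *m (s q : 'cV[A]_2).
Proof.
move=> vX vY bs Qq; have [_ ss] := bs.
have qq : q *m q = q by have [] := Qq.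
have half (U V : 'M[A]_2 -> 'M[A]_2) : vector_field U -> vector_field V ->
    conn_taut q (U q) (fun p => conn_taut p (V p) s) =
      q *m (@dirder R A (rmatrix A 2 1)
        (fun p => dirder (s : _ -> rmatrix A 2 1) p (V p)) q (U q) : 'cV[A]_2)
      + q *m U q *m V q *m (s q : 'cV[A]_2).
  move=> vU vV; have tU := proj1 vU q Qq; have tV := proj1 vV q Qq.
  rewrite /conn_taut.
  rewrite (@dirder_mulmx R A 2 2 1 (fun p => p) _ q (U q) (@smoothQ_id R A)
    (smoothQ_dirder ss vV)) //.
  rewrite dirder_id // mulmxDr !mulmxA qq; congr (_ + _).
  rewrite -(section_normal bs Qq tV) mulmxDr !mulmxA.
  by rewrite (tangent_compress Qq tU) mul0mx add0r.
rewrite /curvature !half // /conn_taut.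
have tXY := lie_bracket_tangent vX vY Qq.
have e := dirder_lie_bracket ss vX vY Qq tXY.
rewrite -[X in _ - _ *m X]e mulmxBr opprB opprD.
rewrite mulmxBr mulmxBl !mulmxA.
have cancel (V : zmodType) (a b c d : V) : a + c + (- b - d) + (b - a) = c - d.
  by rewrite -[b - a]opprB (addrACA a) [LHS]addrAC subrr add0r.
exact: cancel.
Qed.

End Tautological.

(** * The connection of the coefficient bundle *)

Section Coefficient.
Context {R : realType} {A : cstarAlgType R}.
Implicit Types (q X Y m : 'M[A]_2) (s : 'M[A]_2 -> tautological A)
  (phi psi : 'M[A]_2 -> coefficient A) (v w : 'cV[A]_2).

(** An endomorphism of [R(q)] extended to [A^2] by [0] on [N(q)], in matrix form:
    such endomorphisms are functions on [A^2], and their sections cannot be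
    differentiated as they stand. *)
Definition coefmx phi q : 'M[A]_2 :=
  \matrix_(i, j) (phi q (q *m delta_mx j 0 : 'cV[A]_2) : 'cV[A]_2) i 0.

Lemma coefmx_col phi q j :
  coefmx phi q *m (delta_mx j 0 : 'cV[A]_2) = phi q (q *m (delta_mx j 0 : 'cV[A]_2)).
Proof. by rewrite -colE; apply/colP => i; rewrite !mxE. Qed.

Lemma mulmx_delta_eq (M N : 'M[A]_2) :
  (forall j, M *m (delta_mx j 0 : 'cV[A]_2) = N *m (delta_mx j 0 : 'cV[A]_2)) -> M = N.
Proof.
move=> MN; apply/matrixP => i j.
by have /colP/(_ i) := MN j; rewrite -!colE !mxE.
Qed.

(** Right [A]-linearity of [phi q] on the decomposition [w = e_0 w_0 + e_1 w_1]. *)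
Lemma coefmxE phi q w : Qrho q -> endo q (phi q) ->
  coefmx phi q *m w = phi q (q *m w).
Proof.
move=> Qq [_ phiD phiZ].
have rg (v : 'cV[A]_2) : range_of q (q *m v) by exists v.
have wE : w = rmul (delta_mx 0 0) (w 0 0) + rmul (delta_mx 1 0) (w 1 0).
  apply/colP => i; rewrite /rmul !mxE !big_ord1 !mxE !eqxx !mulr1n.
  by case: i => [[|[|i]] Hi] //=; rewrite ?mul1r ?mul0r ?addr0 ?add0r;
    congr (w _ _); apply/val_inj.
have qr (M : 'M[A]_2) v b : M *m rmul v b = rmul (M *m v) b by rewrite /rmul mulmxA.
rewrite [in LHS]wE [in RHS]wE !mulmxDr !qr phiD; last 2 first.
- by rewrite -qr; exact: rg.
- by rewrite -qr; exact: rg.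
by rewrite !phiZ // !coefmx_col.
Qed.

Lemma coefmx_range phi q v : Qrho q -> endo q (phi q) -> range_of q v ->
  phi q v = coefmx phi q *m v.
Proof. by move=> Qq ephi rv; rewrite coefmxE // (proj1 (range_ofE v Qq) rv). Qed.

Lemma coefmx_compress phi q : Qrho q -> endo q (phi q) ->
  q *m coefmx phi q = coefmx phi q.
Proof.
move=> Qq ephi; apply: mulmx_delta_eq => j; rewrite -mulmxA coefmxE //.
by apply/range_ofE => //; have [+ _ _] := ephi; apply; eexists.
Qed.

Lemma coefmx_smooth phi : bsection phi -> @smoothQ R A (rmatrix A 2 2) (coefmx phi).
Proof.
move=> [_ sphi].
have sc (j : 'I_2) := sphi _ (cst_section (delta_mx j 0)).
have st (j : 'I_2) := @smoothQ_mulmx R A 2 1 2 _ _ (sc j)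
  (smoothQ_cst (delta_mx 0 j : rmatrix A 1 2)).
have := smoothQ_add (st 0) (st 1).
congr smoothQ; apply/funext => p; apply/matrixP => i j.
rewrite !mxE !big_ord1 !mxE !eqxx.
by case: j => [[|[|j]] Hj] //=; rewrite ?mulr1 ?mulr0 ?addr0 ?add0r;
  congr ((phi p (p *m delta_mx _ _) : 'cV[A]_2) _ _); apply/val_inj.
Qed.

(** The derivative of the endomorphism-valued map [phi], compressed to [R(q)]. *)
Definition conn_coef q X phi : coefficient A :=
  fun v => q *m (@dirder R A (rmatrix A 2 2) (coefmx phi) q X : 'M[A]_2) *m v.

Lemma mulmx_endo q (M : 'M[A]_2) : endo q (fun v => q *m M *m v).
Proof.
split; first by move=> v _; exists (M *m v); rewrite mulmxA.
  by move=> v w _ _; rewrite mulmxDr.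
by move=> v b _; rewrite /rmul mulmxA.
Qed.

(** By the product rule, [D_X (phi s) = q (X . coefmx phi) s + q coefmx phi (X . s)],
    and the last term is [phi q (D_X s)] by [coefmxE]. *)
Lemma conn_coef_linked : linked_connection conn_coef.
Proof.
move=> q X phi s Qq tX bphi bs; rewrite /conn_taut /conn_coef.
have ephi := proj1 bphi; have sphi := coefmx_smooth bphi; have ss := proj2 bs.
have e : @dirder R A (rmatrix A 2 1) (fun p => phi p (s p)) q X =
    @dirder R A (rmatrix A 2 1) (fun p => coefmx phi p *m (s p : 'cV[A]_2)) q X.
  symmetry; apply: (@dirder_near _ _ (rmatrix A 2 1)) => //.
    exact: (@smoothQ_mulmx R A 2 2 1).
  apply: (@filterE _ (nbhs (q : rmatrix A 2 2))) => p Qp.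
  by apply/esym/coefmx_range; [|exact: ephi|exact: (proj1 bs)].
rewrite e (@dirder_mulmx R A 2 2 1 _ _ _ _ sphi ss) // mulmxDr !mulmxA.
rewrite coefmx_compress //; last exact: ephi.
rewrite [coefmx _ _ *m _]coefmxE //; last exact: ephi.
by rewrite addrAC subrr add0r.
Qed.

(** Every [v] in [R(q)] is the value at [q] of the smooth section [p |-> p v], and
    Leibniz' rule determines the derivative of [phi] at such values. *)
Lemma linked_unique (D : 'M[A]_2 -> 'M[A]_2 ->
    ('M[A]_2 -> coefficient A) -> coefficient A) q X phi :
  linked_connection D -> Qrho q -> tangent q X -> bsection phi ->
  endo_eq q (D q X phi) (conn_coef q X phi).
Proof.
move=> lD Qq tX bphi v rv.
have bs := cst_section v.
have vE : v = (fun p => p *m v) q by rewrite (proj1 (range_ofE v Qq) rv).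
have := lD q X phi _ Qq tX bphi bs; rewrite -conn_coef_linked //.
by rewrite -vE.
Qed.

Lemma conn_coef_connection : connection conn_coef.
Proof.
split.
- by move=> q X phi _ _ _; exact: mulmx_endo.
- move=> X phi vX bphi; split; first by move=> q _; exact: mulmx_endo.
  move=> s bs; apply: (@smoothQ_mulmx R A 2 2 1); last exact: (proj2 bs).
  apply: (@smoothQ_mulmx R A 2 2 2); first exact: smoothQ_id.
  by apply: smoothQ_dirder => //; exact: coefmx_smooth.
- move=> q X phi psi U Qq tX bphi _ oU Uq e v _; rewrite /conn_coef.
  congr (_ *m _ *m _); apply: (@dirder_near _ _ (rmatrix A 2 2)) => //.
    exact: coefmx_smooth.
  apply: filterS (open_nbhs_nbhs (conj oU Uq)) => p Up Qp.
  apply: mulmx_delta_eq => j; rewrite !coefmx_col; apply: e => //.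
  by eexists.
- move=> q X Y phi r Qq tX tY bphi v _; rewrite /conn_coef.
  rewrite (dirder_linearX r (coefmx_smooth bphi) Qq tX tY) mulmxDr mulmxDl.
  by rewrite [q *m _]complex_scale_mulmxr complex_scale_mulmxl.
- move=> q X phi psi z Qq tX bphi bpsi v _; rewrite /conn_coef.
  have sz := smoothQ_complex_scale z (coefmx_smooth bphi).
  have -> : coefmx (fun p => complex_scale z (phi p) + psi p) =
      (fun p => complex_scale z (coefmx phi p) + coefmx psi p).
    by apply/funext => p; apply/matrixP => i j; rewrite !mxE.
  rewrite (@dirder_add _ _ (rmatrix A 2 2) _ _ q X sz (coefmx_smooth bpsi) Qq tX).
  rewrite dirder_complex_scale //; last exact: coefmx_smooth.
  by rewrite mulmxDr mulmxDl complex_scale_mulmxr complex_scale_mulmxl.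
- move=> q X phi f Qq tX bphi sf v rv; rewrite /conn_coef.
  have -> : coefmx (fun p => complex_scale (f p)%:C (phi p)) =
      (fun p => complex_scale (f p)%:C (coefmx phi p)).
    by apply/funext => p; apply/matrixP => i j; rewrite !mxE.
  rewrite (dirder_realscale sf (coefmx_smooth bphi) Qq tX) mulmxDr mulmxDl.
  rewrite !complex_scale_mulmxr !complex_scale_mulmxl.
  rewrite coefmx_compress //; last exact: (proj1 bphi).
  by rewrite -(@coefmx_range phi) //; exact: (proj1 bphi).
Qed.

(** The action turns [coefmx phi] into [m (coefmx phi) sharp m], with the
    base point moved by [rconj m]; then [dirder_conj] applies. *)
Lemma conn_coef_invariant : invariant_connection conn_coef.
Proof.
move=> m q X phi um Qq tX bphi v rv; rewrite /conn_coef /=.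
have sphi := coefmx_smooth bphi.
have Qm := unitary_conj_Qrho um Qq; have tm := unitary_conj_tangent um tX.
have e p : Qrho p -> m *m coefmx phi (sharp m *m p *m m) *m sharp m =
    coefmx (fun p => (fun v => m *m phi (sharp m *m p *m m) (sharp m *m v))
      : coefficient A) p.
  move=> Qp; apply: mulmx_delta_eq => j; rewrite coefmx_col.
  have Qc := rconj_Qrho um Qp.
  have -> : sharp m *m (p *m delta_mx j 0) =
      rconj m p *m (sharp m *m delta_mx j 0 : 'cV[A]_2).
    have [mm' _] := um; rewrite /rconj; move: mm'; move: (sharp m) => m' mm'.
    by rewrite !mulmxA -(mulmxA _ m m') mm' mulmx1.
  rewrite -[RHS]/(m *m phi (rconj m p) (rconj m p *m (sharp m *m delta_mx j 0))).
  rewrite -(coefmxE _ Qc); last exact: (proj1 bphi).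
  by rewrite !mulmxA.
have scm := smoothQ_conj um sphi.
have sm := smoothQ_cst (R := R) (A := A) (m : rmatrix A 2 2).
have sm' := smoothQ_cst (R := R) (A := A) (sharp m : rmatrix A 2 2).
have smc := @smoothQ_mulmx R A 2 2 2 _ _ sm scm.
have E : @dirder R A (rmatrix A 2 2)
    (coefmx (fun p => (fun v => m *m phi (sharp m *m p *m m) (sharp m *m v))
      : coefficient A)) (m *m q *m sharp m) (m *m X *m sharp m)
    = m *m (@dirder R A (rmatrix A 2 2) (coefmx phi) q X : 'M[A]_2) *m sharp m.
  rewrite -(dirder_conj um sphi Qq tX).
  transitivity (@dirder R A (rmatrix A 2 2)
     (fun p => m *m coefmx phi (sharp m *m p *m m) *m sharp m)
     (m *m q *m sharp m) (m *m X *m sharp m)).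
    symmetry; apply: (@dirder_near _ _ (rmatrix A 2 2)) => //.
      exact: (@smoothQ_mulmx R A 2 2 2 _ _ smc sm').
    by apply: (@filterE _ (nbhs (m *m q *m sharp m : rmatrix A 2 2))).
  rewrite (@dirder_mulmx R A 2 2 2 _ _ _ _ smc sm') // dirder_cst // mulmx0 add0r.
  rewrite (@dirder_mulmx R A 2 2 2 _ _ _ _ sm scm) // (dirder_cst _ Qm tm).
  by rewrite mul0mx addr0.
rewrite E; have [_] := um; move: (sharp m) => m' m'm.
by rewrite !mulmxA -(mulmxA _ m' m) m'm mulmx1.
Qed.

End Coefficient.

(** * The Hilbertian product, the curvature and the moment map *)

Section HermitianProduct.
Context {R : realType} {A : cstarAlgType R}.
Implicit Types (q X Y Z a M : 'M[A]_2) (v w x : 'cV[A]_2).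

(** The class [[(x, - theta(X x, Y x))]], for any [x] with [proj_of x = q]: see
    [herm_class]. *)
Definition herm q X Y v : 'cV[A]_2 := q *m (- (X *m Y)) *m v.

(** The imaginary part of [herm q X Y], as [herm q Y X] is its adjoint. *)
Definition symp q X Y v : 'cV[A]_2 :=
  q *m complex_scale (2%:R * 'i%C)^-1 (Y *m X - X *m Y) *m v.

(** The class [[(x, theta(x, a x) / 2i)]], for any [x] with [proj_of x = q]. *)
Definition moment a q v : 'cV[A]_2 :=
  q *m complex_scale (2%:R * 'i%C)^-1 a *m v.

Lemma proj_ofE x v : proj_of x *m v = rmul x (theta x v).
Proof. by rewrite /proj_of /rmul -starmx_rho_mul !mulmxA. Qed.

Lemma mulmx_rmul M x b : M *m rmul x b = rmul (M *m x) b.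
Proof. by rewrite /rmul mulmxA. Qed.

Lemma rmulA x b c : rmul (rmul x b) c = rmul x (b * c).
Proof. by rewrite /rmul -mulmxA -scalar_mxM. Qed.

(** [proj_of x *m v = x theta(x, v)] and [theta] is right [A]-linear in its second
    variable. *)
Lemma compression_class x M :
  is_class x (theta x (M *m x)) (fun v => proj_of x *m M *m v).
Proof. by move=> c; rewrite -mulmxA proj_ofE mulmx_rmul theta_rmulr. Qed.

Lemma is_class_inj x b c phi : Kset x -> is_class x b phi -> is_class x c phi -> b = c.
Proof.
move=> [xx _] bphi cphi; have := bphi 1; rewrite cphi !mulr1.
by move=> /(congr1 (theta x)); rewrite !theta_rmulr xx !mul1r.
Qed.

Lemma thetaN x v : theta x (- v) = - theta x v.
Proof. by rewrite /theta mulmxN mxE. Qed.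

Lemma thetaD x v w : theta x (v + w) = theta x v + theta x w.
Proof. by rewrite /theta mulmxDr mxE. Qed.

Lemma theta_scale x z v : theta x (complex_scale z v) = z *: theta x v.
Proof. by rewrite /theta complex_scale_mulmxr mxE -scalerAl mul1r. Qed.

(** [X] is selfadjoint for [theta]. *)
Lemma theta_tangent x q X Y : tangent q X ->
  theta x (X *m Y *m x) = theta (X *m x) (Y *m x).
Proof. by move=> [X' _]; rewrite -mulmxA theta_sharp [sharp X]X'. Qed.

Lemma herm_class x X Y : tangent (proj_of x) X ->
  is_class x (- theta (X *m x) (Y *m x)) (herm (proj_of x) X Y).
Proof.
move=> tX; rewrite -(theta_tangent x Y tX) -thetaN -mulNmx.
exact: compression_class.
Qed.

Lemma symp_class x X Y : tangent (proj_of x) X -> tangent (proj_of x) Y ->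
  is_class x ((2%:R * 'i%C)^-1 *: (theta (Y *m x) (X *m x) - theta (X *m x) (Y *m x)))
    (symp (proj_of x) X Y).
Proof.
move=> tX tY.
rewrite -(theta_tangent x Y tX) -(theta_tangent x X tY) -thetaN -thetaD -theta_scale.
by rewrite -mulmxBl -complex_scale_mulmxl; exact: compression_class.
Qed.

Lemma tangent_null q X v : Qrho q -> tangent q X -> range_of q v ->
  null_of q (X *m v).
Proof.
move=> Qq tX /(range_ofE v Qq) <-.
by rewrite /null_of /= !mulmxA tangent_compress // mul0mx.
Qed.

(** Symmetry is that of [theta], positivity is that of [- theta] on [N(q)], and
    [2 q - 1] is the identity on [R(q)], so that the complex structure is
    multiplication by [i] there. *)
Lemma herm_hilbertian : hilbertian_product (@herm).
Proof.
split.
- by move=> q X Y *; exact: mulmx_endo.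
- move=> q X Y Z _ _ _ _ v _.
  by rewrite /herm /= mulmxDl opprD mulmxDr mulmxDl.
- move=> q X Y Z _ _ _ _ v _.
  by rewrite /herm /= mulmxDr opprD mulmxDr mulmxDl.
- move=> q X Y Qq tX tY x b Kx pq; move: tX tY; rewrite -pq => tX tY bxy.
  rewrite (is_class_inj Kx bxy (herm_class Y tX)) cstarN theta_star.
  exact: herm_class.
- move=> q X Qq tX x b Kx pq bxx; have [_ _ _ neg] := Qq.
  have rx : range_of q x.
    by apply/range_ofE => //; rewrite -pq proj_ofE (proj1 Kx) /rmul mulmx1.
  have := neg _ (tangent_null Qq tX rx); move: tX bxx; rewrite -pq => tX bxx.
  by rewrite (is_class_inj Kx bxx (herm_class X tX)).
- move=> q X Y r s Qq tX tY v rv; have qv := (proj1 (range_ofE v Qq)) rv.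
  rewrite /herm /complex_structure /=.
  have jv : X *m (Y *m (q *+ 2 - 1%:M)) *m v = X *m Y *m v.
    by rewrite -!mulmxA mulmxBl mulr2n mulmxDl qv mul1mx addrK.
  rewrite complex_scaleA mulmxDr !complex_scale_mulmxr -!mulmxA !mulNmx.
  rewrite mulmxDl !complex_scale_mulmxl !mulmxN complex_scaleN; congr (- _).
  rewrite jv -complex_scaleDl complex_scale_mulmxr !mulmxA; congr complex_scale.
  by apply/eqP; rewrite eq_complex /= !mul0r !mulr0 !mulr1 ?subr0 ?addr0 ?add0r !eqxx.
Qed.

Lemma herm_module_action q X Y Z phi : Qrho q ->
  is_module_action q Y phi Z -> endo_eq q (herm q X Z) (herm q X Y \o phi).
Proof.
move=> Qq [tZ [x [b [Kx pq bphi ZY]]]] v /(range_ofE v Qq) <- /=.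
rewrite -pq proj_ofE bphi /herm !mulmx_rmul -!mulmxA !mulNmx -!mulmxA ZY.
by rewrite mulmx_rmul -!rmulA /rmul !mulmxN !mulNmx !mulmxA.
Qed.

Lemma inv_2i : (2%:R * 'i%C : R[i])^-1 = - ('i%C / 2%:R).
Proof.
have ii : 'i%C * 'i%C = -1 :> R[i] by rewrite -expr2 sqr_i.
have h : (2%:R * 'i%C) * - ('i%C / 2%:R) = 1 :> R[i].
  by rewrite mulrN mulrA -(mulrA 2%:R) ii mulrN1 mulNr opprK divff // pnatr_eq0.
have n0 : 2%:R * 'i%C != 0 :> R[i].
  by apply: contra_eq_neq h => ->; rewrite mul0r eq_sym oner_neq0.
by apply: (mulfI n0); rewrite h mulfV.
Qed.

Lemma symp_curvature (X Y : 'M[A]_2 -> 'M[A]_2) (s : 'M[A]_2 -> tautological A) q :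
  vector_field X -> vector_field Y -> bsection s -> Qrho q ->
  symp q (X q) (Y q) (s q) =
    complex_scale ('i%C / 2%:R) (curvature (@conn_taut R A) X Y s q).
Proof.
move=> vX vY bs Qq; rewrite conn_taut_curvature // /symp inv_2i.
rewrite complex_scale_mulmxr complex_scale_mulmxl -opprB mulmxN mulNmx.
by rewrite /complex_scale scaleNr scaleNr scalerN opprK.
Qed.

Lemma lie_vector_field a : lie_theta a -> vector_field (fun q => a *m q - q *m a).
Proof.
move=> la; split.
  move=> q [qq q' _ _]; split.
    rewrite -[LHS]/(sharp (a *m q - q *m a)) sharpD sharpN !sharpM q' la.
    by rewrite mulmxN mulNmx opprK addrC.
  by rewrite mulmxBl mulmxBr !mulmxA qq -(mulmxA a q q) qq addrA subrK.
have sa := smoothQ_cst (R := R) (A := A) (a : rmatrix A 2 2).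
have sid := @smoothQ_id R A.
have sN := smoothQ_cst (R := R) (A := A) (- a : rmatrix A 2 2).
have := smoothQ_add (@smoothQ_mulmx R A 2 2 2 _ _ sa sid)
  (@smoothQ_mulmx R A 2 2 2 _ _ sid sN).
by congr smoothQ; apply/funext => p; rewrite mulmxN.
Qed.

Lemma moment_section a : bsection (moment a : 'M[A]_2 -> coefficient A).
Proof.
split; first by move=> q _; exact: mulmx_endo.
move=> s bs; apply: (@smoothQ_mulmx R A 2 2 1); last exact: (proj2 bs).
by apply: (@smoothQ_mulmx R A 2 2 2); [exact: smoothQ_id|exact: smoothQ_cst].
Qed.

(** With [b = a / 2i], the matrix of the moment map at [p] is [p b p], of derivative
    [Y b q + q b Y].  The other terms of the symplectic form vanish on [R(q)]
    since [q Y q = 0]. *)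
Lemma moment_gradient a q Y : Qrho q -> tangent q Y ->
  endo_eq q (conn_coef q Y (moment a)) (symp q (a *m q - q *m a) Y).
Proof.
move=> Qq tY v rv; have qv := (proj1 (range_ofE v Qq)) rv.
have [qq _ _ _] := Qq.
pose z : R[i] := (2%:R * 'i%C)^-1; pose b := complex_scale z a.
rewrite /conn_coef.
have -> : coefmx (moment a : 'M[A]_2 -> coefficient A) = (fun p => p *m b *m p).
  by apply/funext => p; apply: mulmx_delta_eq => j; rewrite coefmx_col /moment !mulmxA.
have sb := smoothQ_cst (R := R) (A := A) (b : rmatrix A 2 2).
have sid := @smoothQ_id R A.
have spb := @smoothQ_mulmx R A 2 2 2 _ _ sid sb.
rewrite (@dirder_mulmx R A 2 2 2 _ _ _ _ spb sid) //.
rewrite (@dirder_mulmx R A 2 2 2 _ _ _ _ sid sb) // dirder_cst // mulmx0 add0r.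
rewrite dirder_id //.
have symE : complex_scale z (Y *m (a *m q - q *m a) - (a *m q - q *m a) *m Y) =
    (Y *m b *m q - Y *m q *m b) - (b *m q *m Y - q *m b *m Y).
  rewrite /b !complex_scale_mulmxr !complex_scale_mulmxl.
  rewrite -!complex_scaleN -!complex_scaleDr.
  rewrite -complex_scaleN -complex_scaleDr; congr complex_scale.
  by rewrite mulmxBr mulmxBl !mulmxA.
have qYv : q *m Y *m v = 0 by rewrite -qv mulmxA tangent_compress // mul0mx.
rewrite /symp symE !mulmxBr !mulmxDr !mulmxBl !mulmxDl !mulmxA.
rewrite tangent_compress // qq mul0mx mul0mx subr0.
have -> : q *m b *m q *m Y *m v = 0 by rewrite -!mulmxA (mulmxA q Y) qYv !mulmx0.
by rewrite sub0r opprK addrC.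
Qed.

End HermitianProduct.

Theorem theorem7p2 (R : realType) (A : cstarAlgType R) :
  exists (DC : 'M[A]_2 -> 'M[A]_2 ->
               ('M[A]_2 -> coefficient A) -> coefficient A)
         (h om : 'M[A]_2 -> 'M[A]_2 -> 'M[A]_2 -> 'cV[A]_2 -> 'cV[A]_2),
  [/\ (* 1 *)
      [/\ connection (@conn_taut R A),
          invariant_connection (@conn_taut R A),
          connection DC /\ invariant_connection DC,
          linked_connection DC &
          forall D : 'M[A]_2 -> 'M[A]_2 ->
                     ('M[A]_2 -> coefficient A) -> coefficient A,
            linked_connection D ->
            forall q X phi, Qrho q -> tangent q X -> bsection phi ->
              endo_eq q (D q X phi) (DC q X phi)],
      (* 2 *)
      [/\ hilbertian_product h,
          forall (x : 'cV[A]_2) (X Y : 'M[A]_2), Kset x ->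
            tangent (proj_of x) X -> tangent (proj_of x) Y ->
            is_class x (- theta (X *m x) (Y *m x)) (h (proj_of x) X Y) &
          forall (q X Y Z : 'M[A]_2) (phi : 'cV[A]_2 -> 'cV[A]_2),
            Qrho q -> tangent q X -> tangent q Y -> endo q phi ->
            is_module_action q Y phi Z ->
            endo_eq q (h q X Z) (h q X Y \o phi)],
      (* 3 *)
      (forall q X Y, Qrho q -> tangent q X -> tangent q Y ->
         endo q (om q X Y) /\ is_imaginary_part q (h q X Y) (om q X Y)) /\
      (forall (X Y : 'M[A]_2 -> 'M[A]_2) (s : 'M[A]_2 -> tautological A) q,
         vector_field X -> vector_field Y -> bsection s -> Qrho q ->
         om q (X q) (Y q) (s q) =
           complex_scale ('i%C / 2%:R) (curvature (@conn_taut R A) X Y s q)) &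
      (* 4 *)
      forall a : 'M[A]_2, lie_theta a ->
        vector_field (fun q => a *m q - q *m a) /\
        exists f : 'M[A]_2 -> coefficient A,
          [/\ bsection f,
              forall x, Kset x ->
                is_class x ((2%:R * 'i%C)^-1 *: theta x (a *m x)) (f (proj_of x)) &
              forall q Y, Qrho q -> tangent q Y ->
                endo_eq q (DC q Y f) (om q (a *m q - q *m a) Y)]].

Proof.
exists (@conn_coef R A), (@herm R A), (@symp R A); split.
- split.
  + exact: conn_taut_connection.
  + exact: conn_taut_invariant.
  + by split; [exact: conn_coef_connection|exact: conn_coef_invariant].
  + exact: conn_coef_linked.
  + by move=> D lD q X phi; exact: linked_unique.
- split.
  + exact: herm_hilbertian.
  + by move=> x X Y _ tX _; exact: herm_class.
  + by move=> q X Y Z phi Qq _ _ _; exact: herm_module_action.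
- split; last exact: symp_curvature.
  move=> q X Y Qq tX tY; split; first exact: mulmx_endo.
  move=> x b Kx pq; move: tX tY; rewrite -pq => tX tY bxy.
  rewrite (is_class_inj Kx bxy (herm_class Y tX)) cstarN theta_star opprK addrC.
  exact: symp_class.
- move=> a la; split; first exact: lie_vector_field.
  exists (moment a); split; first exact: moment_section.
    move=> x _; rewrite -theta_scale -complex_scale_mulmxl.
    exact: compression_class.
  by move=> q Y; exact: moment_gradient.
Qed.
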